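(* Let $p$ be a prime and $\mathbf{k}$ a field of characteristic $p$. For $n\ge 0$, the algebra $\mathcal{E}_n(p)$ is a graded commutative finitely generated Gorenstein $\mathbf{k}$-algebra of Krull dimension $n$. If $p=2$ then it is an integral domain, while for $p$ odd it has nilpotent elements. The Poincaré series $f(q)=\sum_{d\ge 0}q^d\dim_{\mathbf{k}}\mathcal{E}_n(p)_d$ is a rational function of $q$ satisfying $f(1/q)=(-q)^nf(q)$.
   Context: An element $a\in\mathbb{Z}[\frac1p]$ is even if $a/2\in\mathbb{Z}[\frac1p]$ and odd otherwise (for $p=2$ every element is even); $(-1)^a$ is $+1$ if $a$ is even and $-1$ if $a$ is odd. A $\mathbb{Z}[\frac1p]$-graded algebra is graded commutative if $yx=(-1)^{|x||y|}xy$ for homogeneous $x,y$, where $|x|$ denotes the degree of $x$. If $R$ is a $\mathbb{Z}[\frac1p]$-graded $\mathbf{k}$-algebra, $\mathrm{Int}(R)$ is the $\mathbb{Z}$-graded subalgebra $\bigoplus_{m\in\mathbb{Z}}R_m$ spanned by the homogeneous elements of integer degree. Definition of $\mathcal{E}_n(p)$. For $p=2$: $R(n,2)=\mathbf{k}[x_1,\dots,x_n]$ is the commutative polynomial algebra graded by $|x_i|=\frac{2^i-1}{2^i}$, and $\mathcal{E}_n(2)=\mathrm{Int}(R(n,2))$. For $p$ odd: $R(n,p)=\mathbf{k}[x_1,\dots,x_n]\otimes\Lambda(\xi_1,\dots,\xi_n)$ is the graded commutative algebra with polynomial generators $x_i$ of degree $|x_i|=\frac{2(p^i-1)}{p^i}$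 (even) and exterior generators $\xi_i$ of degree $|\xi_i|=|x_i|-1=\frac{p^i-2}{p^i}$ (odd), and $\mathcal{E}_n(p)=\mathrm{Int}(R(n,p))$. $\mathcal{E}_n(p)_d$ denotes the degree $d$ part of $\mathcal{E}_n(p)$. For $p$ odd the algebra is graded commutative rather than commutative: Krull dimension means that of the commutative quotient by the nilpotent ideal, and Gorenstein means Cohen–Macaulay (a homogeneous system of parameters is a regular sequence) with the quotient by a homogeneous regular system of parameters being a graded Frobenius algebra.
   Formalization: The claim that for p odd the algebra has nilpotent elements is read as nonzero nilpotents and proved for n ≥ 1 only, since for n = 0 the algebra is the field k, which has none. *)

(* Defs.v *)
From HB Require Import structures.
From mathcomp Require Import all_boot all_order all_algebra.
From mathcomp Require Import mpoly.
From mathcomp Require boolp.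

Set Implicit Arguments.
Unset Strict Implicit.
Unset Printing Implicit Defensive.

Import Order.TTheory GRing.Theory Num.Theory.
Local Open Scope ring_scope.

(** * Graded algebras *)

(* [gr_dec] and [gr_free] together say that the algebra is the (internal)
   direct sum of its homogeneous parts. *)
Record gralg (G : zmodType) (k : fieldType) := GrAlg {
  gr_car :> algType k;
  gr_part : G -> gr_car -> Prop;
  gr_part0 : forall d, gr_part d 0;
  gr_partL : forall d (a : k) x y,
    gr_part d x -> gr_part d y -> gr_part d (a *: x + y);
  gr_part1 : gr_part 0 1;
  gr_partM : forall d e x y,
    gr_part d x -> gr_part e y -> gr_part (d + e) (x * y);
  gr_dec : forall x, exists2 s : seq gr_car,
    (forall y, y \in s -> exists d, gr_part d y) & x = \sum_(y <- s) y;
  gr_free : forall (s : seq G) (f : G -> gr_car),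
    uniq s -> (forall d, gr_part d (f d)) -> \sum_(d <- s) f d = 0 ->
    forall d, d \in s -> f d = 0
}.
Arguments gr_part {G k} g d x.

(** * The subalgebra Int(R) *)

Section Int.
Variables (k : fieldType) (R : gralg rat k).

Definition int_span (x : R) : Prop :=
  exists2 s : seq R,
    (forall y, y \in s -> exists m : int, gr_part R m%:~R y)
    & x = \sum_(y <- s) y.

Definition int_pred : {pred R} := fun x => boolp.asbool (int_span x).

Lemma int_predP x : reflect (int_span x) (x \in int_pred).
Proof. exact: boolp.asboolP. Qed.

Lemma int_pred_part (m : int) x : gr_part R m%:~R x -> x \in int_pred.
Proof.
move=> mx; apply/int_predP; exists [:: x]; last by rewrite big_seq1.
by move=> y; rewrite inE => /eqP->; exists m.
Qed.

Lemma int_pred_subalg : subalg_closed int_pred.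
Proof.
split.
- exact/(@int_pred_part 0)/gr_part1.
- move=> a x y /int_predP[s sP ->] /int_predP[t tP ->]; apply/int_predP.
  exists ([seq a *: u | u <- s] ++ t); last first.
    by rewrite big_cat /= big_map scaler_sumr.
  move=> z; rewrite mem_cat => /orP[/mapP[u /sP[m mu] ->]|/tP//].
  by exists m; rewrite -[_ *: _]addr0; apply/gr_partL/gr_part0.
- move=> x y /int_predP[s sP ->] /int_predP[t tP ->]; apply/int_predP.
  exists [seq u * v | u <- s, v <- t].
    move=> z /allpairsP[[u v] /= [/sP[m mu] /tP[m' mv] ->]].
    by exists (m + m'); rewrite intrD; apply: gr_partM.
  rewrite big_allpairs_dep mulr_suml; apply: eq_bigr => u _.
  by rewrite mulr_sumr.
Qed.

HB.instance Definition _ :=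
  GRing.isSubalgClosed.Build k R int_pred int_pred_subalg.

Inductive Int_car := IntCar (x : R) of x \in int_pred.
Definition Int_val (u : Int_car) : R := let: IntCar x _ := u in x.

HB.instance Definition _ := [isSub for Int_val].
HB.instance Definition _ := [Choice of Int_car by <:].
HB.instance Definition _ := [SubChoice_isSubAlgebra of Int_car by <:].

Definition Int_part (m : int) (u : Int_car) : Prop :=
  gr_part R m%:~R (val u).

Fact Int_part0 m : Int_part m 0.
Proof. by rewrite /Int_part raddf0; apply: gr_part0. Qed.

Fact Int_partL m (a : k) x y :
  Int_part m x -> Int_part m y -> Int_part m (a *: x + y).
Proof. by rewrite /Int_part linearP; apply: gr_partL. Qed.

Fact Int_part1 : Int_part 0 1.
Proof. by rewrite /Int_part rmorph1; apply: gr_part1. Qed.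

Fact Int_partM m m' x y :
  Int_part m x -> Int_part m' y -> Int_part (m + m') (x * y).
Proof. by rewrite /Int_part rmorphM intrD; apply: gr_partM. Qed.

Fact Int_dec x : exists2 s : seq Int_car,
  (forall y, y \in s -> exists m, Int_part m y) & x = \sum_(y <- s) y.
Proof.
case: x => x xP; have /int_predP[s sP xs] := xP.
exists (pmap insub s).
  move=> y; rewrite mem_pmap_sub => /sP[m my].
  by exists m.
apply: val_inj; rewrite raddf_sum /= xs.
have {x xP xs} : all (mem int_pred) s.
  by apply/allP => y /sP[m]; apply: int_pred_part.
elim: s {sP} => [|y s IH] /=; first by rewrite !big_nil.
case/andP=> yP sP; rewrite insubT /= !big_cons -IH //.
Qed.

Fact Int_free (s : seq int) (f : int -> Int_car) :
  uniq s -> (forall m, Int_part m (f m)) -> \sum_(m <- s) f m = 0 ->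
  forall m, m \in s -> f m = 0.
Proof.
move=> s_uniq fP f0 m ms; apply: val_inj; rewrite raddf0.
pose g (d : rat) : R := if d \is a Num.int then val (f (Num.floor d)) else 0.
have gE i : g i%:~R = val (f i) by rewrite /g intr_int intrKfloor.
have inj : injective (intr : int -> rat) by apply: intr_inj.
rewrite -[val _]gE.
apply: (@gr_free _ _ R [seq i%:~R | i <- s]); last exact: map_f.
- by rewrite map_inj_uniq.
- move=> d; rewrite /g; case: ifP => [|_]; last exact: gr_part0.
  by case/intrP=> i ->; rewrite intrKfloor; apply: fP.
- rewrite big_map; transitivity (val (\sum_(i <- s) f i)).
    by rewrite raddf_sum; apply: eq_bigr => i _; rewrite gE.
  by rewrite f0 raddf0.
Qed.

Definition Int : gralg int k :=
  @GrAlg int k (Int_car : algType k) Int_part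
    Int_part0 Int_partL Int_part1 Int_partM Int_dec Int_free.

End Int.

(** * Exterior algebras *)

(* [ext A n] is the A-algebra Lambda_A(xi_1, ..., xi_n), that is
   A (x)_k Lambda_k(xi_1, ..., xi_n): the free A-module on the products xi_S of
   the generators indexed by S : {set 'I_n}, taken in increasing order. *)

Section Exterior.
Variables (k : fieldType) (A : comAlgType k) (n : nat).
Implicit Types (S T U V : {set 'I_n}).

Definition ext : Type := {ffun {set 'I_n} -> A}.
HB.instance Definition _ := GRing.Lmodule.on ext.
Implicit Types f g h : ext.

Definition inversions S T : nat :=
  #|[set ij : 'I_n * 'I_n | [&& ij.1 \in S, ij.2 \in T & (ij.2 < ij.1)%N]]|.

(* xi_S * xi_T = ext_sign S T * xi_(S :|: T) *)
Definition ext_sign S T : A :=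
  if [disjoint S & T] then (-1) ^+ inversions S T else 0.

Definition ext_mul f g : ext :=
  [ffun U => \sum_S \sum_(T | S :|: T == U) ext_sign S T * (f S * g T)].

Definition ext_one : ext := [ffun U => (U == set0)%:R].

Lemma inversionsUl S T V : [disjoint S & T] ->
  inversions (S :|: T) V = (inversions S V + inversions T V)%N.
Proof.
move=> dST; rewrite /inversions -cardsUI [X in (_ + X)%N](_ : _ = 0%N).
  rewrite addn0; apply: eq_card => -[i j]; rewrite !inE /=.
  by case: (i \in S); case: (i \in T); rewrite ?orbF ?orbb.
apply: eq_card0 => -[i j]; rewrite !inE /=.
case iS: (i \in S); case iT: (i \in T); rewrite ?andbF //=.
by have := disjointFr dST iS; rewrite iT.
Qed.

Lemma inversionsUr S T V : [disjoint T & V] ->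
  inversions S (T :|: V) = (inversions S T + inversions S V)%N.
Proof.
move=> dTV; rewrite /inversions -cardsUI [X in (_ + X)%N](_ : _ = 0%N).
  rewrite addn0; apply: eq_card => -[i j]; rewrite !inE /=.
  by case: (j \in T); case: (j \in V); rewrite ?andbF ?orbF ?orbb.
apply: eq_card0 => -[i j]; rewrite !inE /=.
case jT: (j \in T); case jV: (j \in V); rewrite ?andbF //=.
by have := disjointFr dTV jT; rewrite jV.
Qed.

Lemma disjointUl S T V :
  [disjoint S :|: T & V] = [disjoint S & V] && [disjoint T & V].
Proof. by rewrite -!setI_eq0 setIUl setU_eq0. Qed.

Lemma ext_signA S T V :
  ext_sign (S :|: T) V * ext_sign S T = ext_sign S (T :|: V) * ext_sign T V.
Proof.
rewrite /ext_sign disjointUl.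
rewrite ![[disjoint S & T :|: V]]disjoint_sym disjointUl.
rewrite ![[disjoint _ & S]]disjoint_sym.
case dST: [disjoint S & T]; case dSV: [disjoint S & V];
  case dTV: [disjoint T & V]; rewrite /= ?mul0r ?mulr0 //.
by rewrite -!exprD inversionsUl // inversionsUr // -addnA addnC -!addnA;
  congr (_ ^+ _); rewrite addnC addnA addnAC.
Qed.

Lemma ext_sign0l T : ext_sign set0 T = 1.
Proof.
rewrite /ext_sign -setI_eq0 set0I eqxx /inversions eq_card0 ?expr0 //.
by move=> [i j]; rewrite !inE.
Qed.

Lemma ext_sign0r T : ext_sign T set0 = 1.
Proof.
rewrite /ext_sign -setI_eq0 setI0 eqxx /inversions eq_card0 ?expr0 //.
by move=> [i j]; rewrite !inE /= andbF.
Qed.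

Lemma ext_mulE f g U : ext_mul f g U =
  \sum_S \sum_T if S :|: T == U then ext_sign S T * (f S * g T) else 0.
Proof. by rewrite ffunE; apply: eq_bigr => S _; rewrite big_mkcond. Qed.

Lemma ext_mul_sum (c : {set 'I_n} -> A) f g :
  \sum_W c W * ext_mul f g W =
  \sum_S \sum_T c (S :|: T) * (ext_sign S T * (f S * g T)).
Proof.
transitivity (\sum_W \sum_S \sum_T
    if W == S :|: T then c W * (ext_sign S T * (f S * g T)) else 0).
  apply: eq_bigr => W _; rewrite ext_mulE mulr_sumr; apply: eq_bigr => S _.
  rewrite mulr_sumr; apply: eq_bigr => T _.
  by rewrite eq_sym; case: eqP; rewrite ?mulr0.
rewrite exchange_big; apply: eq_bigr => S _.
rewrite exchange_big; apply: eq_bigr => T _.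
by rewrite -big_mkcond big_pred1_eq.
Qed.

Fact ext_mulA : associative ext_mul.
Proof.
move=> f g h; apply/ffunP => U; rewrite !ext_mulE.
transitivity (\sum_S f S * \sum_W
    (if S :|: W == U then ext_sign S W else 0) * ext_mul g h W).
  apply: eq_bigr => S _; rewrite mulr_sumr; apply: eq_bigr => W _.
  by case: eqP => _; rewrite ?mul0r ?mulr0 // mulrCA.
symmetry; rewrite exchange_big /=.
transitivity (\sum_V h V * \sum_W
    (if W :|: V == U then ext_sign W V else 0) * ext_mul f g W).
  apply: eq_bigr => V _; rewrite mulr_sumr; apply: eq_bigr => W _.
  by case: eqP => _; rewrite ?mul0r ?mulr0 // mulrCA mulrC -mulrA mulrCA mulrA.
transitivity (\sum_S \sum_T \sum_V (if S :|: T :|: V == U then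
    ext_sign (S :|: T) V * ext_sign S T * (f S * g T * h V) else 0)).
  transitivity (\sum_V \sum_S \sum_T (if S :|: T :|: V == U then
    ext_sign (S :|: T) V * ext_sign S T * (f S * g T * h V) else 0)).
    apply: eq_bigr => V _; rewrite ext_mul_sum mulr_sumr.
    apply: eq_bigr => S _; rewrite mulr_sumr; apply: eq_bigr => T _.
    case: eqP => _; last by rewrite mul0r mulr0.
    by rewrite mulrC !mulrA.
  by rewrite exchange_big; apply: eq_bigr => S _; rewrite exchange_big.
apply: eq_bigr => S _; rewrite ext_mul_sum mulr_sumr.
apply: eq_bigr => T _; rewrite mulr_sumr; apply: eq_bigr => V _.
rewrite setUA; case: eqP => _; last by rewrite mul0r mulr0.
rewrite ext_signA -!mulrA [RHS]mulrCA; congr (ext_sign S _ * _).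
by rewrite mulrCA.
Qed.

Fact ext_mul1l : left_id ext_one ext_mul.
Proof.
move=> f; apply/ffunP => U; rewrite ext_mulE (bigD1 set0) //= [X in _ + X]big1 => [|S /negPf S0].
  rewrite addr0 -big_mkcond (eq_bigl (pred1 U)) => [|T]; last by rewrite set0U.
  by rewrite big_pred1_eq ext_sign0l ffunE eqxx !mul1r.
by apply: big1 => T _; rewrite ffunE S0 mul0r mulr0 if_same.
Qed.

Fact ext_mul1r : right_id ext_one ext_mul.
Proof.
move=> f; apply/ffunP => U; rewrite ext_mulE exchange_big.
rewrite (bigD1 set0) //= [X in _ + X]big1 => [|S /negPf S0].
  rewrite addr0 -big_mkcond (eq_bigl (pred1 U)) => [|T]; last by rewrite setU0.
  by rewrite big_pred1_eq ext_sign0r ffunE eqxx mul1r mulr1.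
by apply: big1 => T _; rewrite ffunE S0 !mulr0 if_same.
Qed.

Fact ext_mulDl : left_distributive ext_mul +%R.
Proof.
move=> f g h; apply/ffunP => U; rewrite [in RHS]ffunE !ext_mulE -big_split.
apply: eq_bigr => S _; rewrite -big_split; apply: eq_bigr => T _ /=.
by case: eqP => _; rewrite ?addr0 // ffunE mulrDl mulrDr.
Qed.

Fact ext_mulDr : right_distributive ext_mul +%R.
Proof.
move=> f g h; apply/ffunP => U; rewrite [in RHS]ffunE !ext_mulE -big_split.
apply: eq_bigr => S _; rewrite -big_split; apply: eq_bigr => T _ /=.
by case: eqP => _; rewrite ?addr0 // ffunE !mulrDr.
Qed.

Fact ext_oner_neq0 : ext_one != 0.
Proof.
apply/eqP => /ffunP/(_ set0); rewrite !ffunE eqxx.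
exact/eqP/oner_neq0.
Qed.

HB.instance Definition _ := GRing.Zmodule_isNzRing.Build ext
  ext_mulA ext_mul1l ext_mul1r ext_mulDl ext_mulDr ext_oner_neq0.

Fact ext_scaleAl (a : k) f g : a *: (f * g) = (a *: f) * g.
Proof.
apply/ffunP => U; rewrite ffunE [in LHS]ext_mulE [in RHS]ext_mulE scaler_sumr.
apply: eq_bigr => S _; rewrite scaler_sumr; apply: eq_bigr => T _.
by case: eqP => _; rewrite ?scaler0 // ffunE -scalerAl -scalerAr.
Qed.

HB.instance Definition _ := GRing.Lmodule_isLalgebra.Build k ext ext_scaleAl.

Fact ext_scaleAr (a : k) f g : a *: (f * g) = f * (a *: g).
Proof.
apply/ffunP => U; rewrite ffunE [in LHS]ext_mulE [in RHS]ext_mulE scaler_sumr.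
apply: eq_bigr => S _; rewrite scaler_sumr; apply: eq_bigr => T _.
by case: eqP => _; rewrite ?scaler0 // ffunE -!scalerAr.
Qed.

HB.instance Definition _ := GRing.Lalgebra_isAlgebra.Build k ext ext_scaleAr.

End Exterior.

(** * The algebras R(n,p) and E_n(p) *)

Section AlgebraR.
Variables (k : fieldType) (n p : nat).
Implicit Types (f g : {mpoly k[n]}) (F G : ext {mpoly k[n]} n).

(* i : 'I_n indexes the generators x_(i+1) and xi_(i+1), whence the exponents
   i.+1 *)
Definition xdeg (i : 'I_n) : rat :=
  if p == 2%N then (2%:R ^+ i.+1 - 1) / 2%:R ^+ i.+1
  else 2%:R * (p%:R ^+ i.+1 - 1) / p%:R ^+ i.+1.

Definition xideg (i : 'I_n) : rat := xdeg i - 1.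

Definition mondeg (m : 'X_{1..n}) : rat := \sum_(i < n) xdeg i *+ m i.

Definition setdeg (S : {set 'I_n}) : rat := \sum_(i in S) xideg i.

Definition poly_part (d : rat) f : Prop :=
  forall m, m \in msupp f -> mondeg m = d.

Fact mondeg0 : mondeg 0%MM = 0.
Proof. by rewrite /mondeg big1 // => i _; rewrite mnm0E. Qed.

Fact mondegD m1 m2 : mondeg (m1 + m2)%MM = mondeg m1 + mondeg m2.
Proof.
by rewrite /mondeg -big_split; apply: eq_bigr => i _; rewrite mnmDE mulrnDr.
Qed.

Fact poly_part0 d : poly_part d 0.
Proof. by move=> m; rewrite msupp0. Qed.

Fact poly_partL d (a : k) f g :
  poly_part d f -> poly_part d g -> poly_part d (a *: f + g).
Proof.
move=> fd gd m /msuppD_le; rewrite mem_cat => /orP[/msuppZ_le|].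
  exact: fd.
exact: gd.
Qed.

Fact poly_part1 : poly_part 0 1.
Proof. by move=> m; rewrite msupp1 inE => /eqP->; apply: mondeg0. Qed.

Fact poly_partM d e f g :
  poly_part d f -> poly_part e g -> poly_part (d + e) (f * g).
Proof.
move=> fd ge m /msuppM_le /allpairsP[[m1 m2] /= [/fd <- /ge <- ->]].
exact: mondegD.
Qed.

Fact poly_dec f : exists2 s : seq {mpoly k[n]},
  (forall g, g \in s -> exists d, poly_part d g) & f = \sum_(g <- s) g.
Proof.
exists [seq f@_m *: 'X_[m] | m <- msupp f]; last by rewrite big_map -mpolyE.
move=> g /mapP[m _ ->]; exists (mondeg m) => m' /msuppZ_le.
by rewrite msuppX inE => /eqP->.
Qed.

Fact poly_free (s : seq rat) (f : rat -> {mpoly k[n]}) :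
  uniq s -> (forall d, poly_part d (f d)) -> \sum_(d <- s) f d = 0 ->
  forall d, d \in s -> f d = 0.
Proof.
move=> s_uniq fP f0 d ds; apply/mpolyP => m; rewrite mcoeff0.
have [/fP md|] := boolP (m \in msupp (f d)); last first.
  by move/memN_msupp_eq0.
have := congr1 (mcoeff m) f0; rewrite raddf_sum mcoeff0 (bigD1_seq d) //=.
rewrite [X in _ + X]big1 ?addr0 // => e ed; apply: memN_msupp_eq0.
by apply: contra ed => /fP <-; rewrite md.
Qed.

Definition polyR : gralg rat k :=
  @GrAlg rat k ({mpoly k[n]} : algType k) poly_part
    poly_part0 poly_partL poly_part1 poly_partM poly_dec poly_free.

(* the coefficient of xi_S in a homogeneous element of degree d is homogeneous
   of degree d - |xi_S| *)
Definition ext_part (d : rat) F : Prop :=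
  forall S, poly_part (d - setdeg S) (F S).

Fact ext_part0 d : ext_part d 0.
Proof. by move=> S; rewrite ffunE; apply: poly_part0. Qed.

Fact ext_partL d (a : k) F G :
  ext_part d F -> ext_part d G -> ext_part d (a *: F + G).
Proof. by move=> Fd Gd S; rewrite !ffunE; apply: poly_partL. Qed.

Fact ext_part1 : ext_part 0 1.
Proof.
move=> S; rewrite ffunE; case: eqP => [->|_]; last exact: poly_part0.
by rewrite /setdeg big_set0 subr0; apply: poly_part1.
Qed.

Fact ext_partM d e F G :
  ext_part d F -> ext_part e G -> ext_part (d + e) (F * G).
Proof.
move=> Fd Ge U; rewrite ffunE.
have addP a f g : poly_part a f -> poly_part a g -> poly_part a (f + g).
  by move=> fa ga; rewrite -[f]scale1r; apply: poly_partL.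
apply: (big_ind (poly_part _)); [exact: poly_part0 | exact: addP |] => S _.
apply: (big_ind (poly_part _)); [exact: poly_part0 | exact: addP |] => T STU.
rewrite /ext_sign; case: ifP => [dST|_]; last first.
  by rewrite mul0r; apply: poly_part0.
have -> : d + e - setdeg U = d - setdeg S + (e - setdeg T).
  rewrite -(eqP STU) /setdeg (big_setID S) /= setUK.
  rewrite (_ : (S :|: T) :\: S = T); first by rewrite opprD addrACA.
  by rewrite setDUl setDv set0U; apply/setDidPl; rewrite disjoint_sym.
have := poly_partM (Fd S) (Ge T); rewrite -signr_odd; case: odd => FG.
  by rewrite expr1 mulN1r -scaleN1r -[_ *: _]addr0; apply/poly_partL/poly_part0.
by rewrite mul1r.
Qed.

Fact ext_dec F : exists2 s : seq (ext {mpoly k[n]} n),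
  (forall G, G \in s -> exists d, ext_part d G) & F = \sum_(G <- s) G.
Proof.
pose mono S f : ext {mpoly k[n]} n := [ffun U => if U == S then f else 0].
have monoP S f d : poly_part d f -> ext_part (d + setdeg S) (mono S f).
  move=> fd U; rewrite ffunE; case: eqP => [->|_]; last exact: poly_part0.
  by rewrite addrK.
exists [seq mono B ((F B)@_m *: 'X_[m]) | B <- enum {set 'I_n}, m <- msupp (F B)].
  move=> G /allpairsPdep[S [m [_ _ ->]]]; exists (mondeg m + setdeg S).
  by apply: monoP => m' /msuppZ_le; rewrite msuppX inE => /eqP->.
rewrite big_allpairs_dep big_enum /=; apply/ffunP => U.
rewrite sum_ffunE (bigD1 U) //= [X in _ + X]big1 => [|S SU]; last first.
  rewrite sum_ffunE big1 // => m _; rewrite ffunE eq_sym.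
  by rewrite (negPf SU).
rewrite addr0 sum_ffunE [LHS]mpolyE; apply: eq_bigr => m _.
by rewrite ffunE eqxx.
Qed.

Fact ext_free (s : seq rat) (F : rat -> ext {mpoly k[n]} n) :
  uniq s -> (forall d, ext_part d (F d)) -> \sum_(d <- s) F d = 0 ->
  forall d, d \in s -> F d = 0.
Proof.
move=> s_uniq FP F0 d ds; apply/ffunP => S; rewrite [RHS]ffunE.
have := @poly_free [seq e - setdeg S | e <- s] (fun e => F (e + setdeg S) S).
move=> /(_ _ _ _ (d - setdeg S)); rewrite subrK; apply; last exact: map_f.
- by rewrite map_inj_uniq //; apply: addIr.
- by move=> e; have := FP (e + setdeg S) S; rewrite addrK.
- rewrite big_map; have := congr1 (fun G : ext _ _ => G S) F0.
  rewrite sum_ffunE ffunE => F0S; rewrite -[RHS]F0S; apply: eq_bigr => e _.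
  by rewrite subrK.
Qed.

Definition polyextR : gralg rat k :=
  @GrAlg rat k (ext {mpoly k[n]} n : algType k) ext_part
    ext_part0 ext_partL ext_part1 ext_partM ext_dec ext_free.

Definition algR : gralg rat k := if p == 2%N then polyR else polyextR.

Definition algE : gralg int k := Int algR.

End AlgebraR.

(** * Graded commutativity *)

Definition Zinv (p : nat) (a : rat) : Prop :=
  exists (m : int) (j : nat), a = m%:~R / p%:R ^+ j.

(* parity of an element a of Z[1/p] *)
Definition oddZinv (p : nat) (a : rat) : bool := ~~ boolp.asbool (Zinv p (a / 2%:R)).

Definition graded_commutative (p : nat) (k : fieldType) (A : gralg int k) : Prop :=
  forall (d e : int) (x y : A), gr_part A d x -> gr_part A e y ->
    y * x = (-1) ^+ oddZinv p (d%:~R * e%:~R) * (x * y).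

(** * Subalgebras, ideals and Krull dimension *)

Section Algebra.
Variables (k : fieldType) (A : algType k).

Definition is_subalg (B : A -> Prop) : Prop :=
  [/\ B 1, forall (a : k) x y, B x -> B y -> B (a *: x + y)
    & forall x y, B x -> B y -> B (x * y)].

Definition gen_subalg (s : seq A) (x : A) : Prop :=
  forall B, is_subalg B -> (forall y, y \in s -> B y) -> B x.

Definition finitely_generated : Prop :=
  exists s : seq A, forall x, gen_subalg s x.

Definition module_finite_over (s : seq A) : Prop :=
  exists t : seq A, forall x, exists2 c : nat -> A,
    (forall i, gen_subalg s (c i)) & x = \sum_(i < size t) c i * t`_i.

Definition dim_is (V : A -> Prop) (m : nat) : Prop :=
  exists2 b : 'I_m -> A, (forall i, V (b i)) &
    forall x, V x -> exists! c : 'rV[k]_m, x = \sum_(i < m) c 0 i *: b i.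

End Algebra.

Section Ideals.
Variable A : nzRingType.

Definition is_ideal (I : A -> Prop) : Prop :=
  [/\ I 0, forall x y, I x -> I y -> I (x + y)
    & forall a x, I x -> I (a * x) /\ I (x * a)].

Definition gen_ideal (s : seq A) (x : A) : Prop :=
  forall I, is_ideal I -> (forall y, y \in s -> I y) -> I x.

(* [s]`_i is a non-zero-divisor modulo the previous terms, and the quotient by
   the whole sequence is non-zero *)
Definition regular_seq (s : seq A) : Prop :=
  (forall i, (i < size s)%N -> forall a,
     gen_ideal (take i s) (s`_i * a) -> gen_ideal (take i s) a)
  /\ ~ gen_ideal s 1.

Definition nilpotent (x : A) : Prop := exists m : nat, x ^+ m = 0.

(* The next three notions are only meant for commutative A. *)
Definition prime_ideal (P : A -> Prop) : Prop :=
  [/\ is_ideal P, ~ P 1 & forall x y, P (x * y) -> P x \/ P y].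

Definition prime_chain (m : nat) : Prop :=
  exists P : nat -> A -> Prop,
    (forall i, (i <= m)%N -> prime_ideal (P i)) /\
    (forall i, (i < m)%N ->
       (forall x, P i x -> P i.+1 x) /\ exists2 x, P i.+1 x & ~ P i x).

Definition com_krull_dim (d : nat) : Prop :=
  prime_chain d /\ forall m, prime_chain m -> (m <= d)%N.

Definition integral_domain : Prop :=
  (forall x y : A, x * y = y * x) /\
  (forall x y : A, x * y = 0 -> x = 0 \/ y = 0).

End Ideals.

(* B, with the surjection pi, is the quotient of A by I. *)
Definition is_quotient (A B : nzRingType) (pi : {rmorphism A -> B})
    (I : A -> Prop) : Prop :=
  (forall b, exists a, pi a = b) /\ (forall a, pi a = 0 <-> I a).

(* For p odd the algebras are not commutative, and the Krull dimension is that
   of the commutative quotient by the ideal of nilpotent elements. *)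
Definition krull_dim (p : nat) (A : nzRingType) (d : nat) : Prop :=
  if p == 2%N then com_krull_dim A d
  else exists (B : comNzRingType) (pi : {rmorphism A -> B}),
    is_quotient pi (@nilpotent A) /\ com_krull_dim B d.

(** * Gorenstein graded algebras *)

Section Gorenstein.
Variables (k : fieldType).
Implicit Types A B : gralg int k.

Definition hsop (p : nat) A (s : seq A) : Prop :=
  [/\ krull_dim p A (size s),
      forall x, x \in s -> exists2 d : int, 0 < d & gr_part A d x
    & module_finite_over s].

(* finite-dimensional, with a homogeneous linear form eps such that the pairing
   (x, y) |-> eps (x * y) is perfect *)
Definition graded_frobenius B : Prop :=
  (exists m, dim_is (fun _ : B => True) m) /\
  exists (c : int) (eps : {linear B -> k^o}),
    [/\ forall d x, gr_part B d x -> d <> c -> eps x = 0,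
        forall x, (forall y, eps (x * y) = 0) -> x = 0
      & forall y, (forall x, eps (x * y) = 0) -> y = 0].

Definition gorenstein (p : nat) A : Prop :=
  exists s : seq A, [/\ hsop p s, regular_seq s &
    exists (B : gralg int k) (pi : {lrmorphism A -> B}),
      [/\ is_quotient pi (gen_ideal s),
          forall d x, gr_part A d x -> gr_part B d (pi x)
        & graded_frobenius B]].

(** * Poincare series *)

Definition poincare_coef A (h : nat -> nat) : Prop :=
  forall d : nat, dim_is (gr_part A d%:Z) (h d).

End Gorenstein.

(* the formal power series sum_d h_d q^d is the expansion of P / Q *)
Definition series_eq_ratio (h : nat -> nat) (P Q : {poly rat}) : Prop :=
  Q != 0 /\ forall d : nat, \sum_(i < d.+1) Q`_i * (h (d - i)%N)%:R = P`_d.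

Definition qvar : {fraction {poly rat}} := tofrac 'X.

(* the value of P / Q at z in the field Q(q) *)
Definition ratio_at (P Q : {poly rat}) (z : {fraction {poly rat}}) :
    {fraction {poly rat}} :=
  (map_poly (fun c : rat => tofrac c%:P) P).[z]
    / (map_poly (fun c : rat => tofrac c%:P) Q).[z].

(* Main.v *)
(* R(n,p) is free over k[x_1, ..., x_n] with a homogeneous basis (e_t), namely
   1 or the products xi_S, so Int(R) has as a k-basis the monomials x^m e_t of
   integral degree.  The powers y_i = x_i^(p^i) have integral degree, and every
   monomial is a product of the y_i and of a residual one, with all
   m_i < p^i: hence Int(R) is finite over k[y_1, ..., y_n], the y_i form a
   regular sequence, and the quotient has the residual monomials as a basis.
   These are permuted by (m, t) |-> (mtop - m, t^c), which gives both the
   Frobenius form (the coefficient of the socle monomial) and the palindromic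
   numerator of the Poincare series P(q) / prod_i (1 - q^(deg y_i)); the
   functional equation amounts to deg(socle) = sum_i deg(y_i) - n.  For p = 2 an
   integral degree forces m_n to be even, so that mtop has exponent 2^n - 2 at
   x_n.  The Krull dimension is bounded by n because monomials in elements
   x_i of P_(i+1) \ P_i, for a chain of primes P_0 < ... < P_m, are linearly
   independent, while polynomials in n variables grow like N^n. *)
From HB Require Import structures.
Require Import Defs.
From mathcomp Require Import all_boot all_order all_algebra.
From mathcomp Require Import mpoly.
From mathcomp Require boolp.
From mathcomp Require Import zify ring lra.

Set Implicit Arguments.
Unset Strict Implicit.
Unset Printing Implicit Defensive.

Import Order.TTheory GRing.Theory Num.Theory.
Local Open Scope ring_scope.

(** * Quotients of graded algebras *)

(** A degree-preserving idempotent with kernel [I] selects normal forms modulo [I]. The quotient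
    algebra is then carried by its fixed points, with product the normal form of the product in
    [A]. *)
Record retraction (G : zmodType) (k : fieldType) (A : gralg G k)
    (I : A -> Prop) := Retraction {
  retr :> {linear A -> A};
  retr_ideal : is_ideal I;
  retr_proper : ~ I 1;
  retr_ker : forall x, retr x = 0 <-> I x;
  retrK : forall x, retr (retr x) = retr x;
  retr_part : forall d x, gr_part A d x -> gr_part A d (retr x)
}.

Section Quotient.
Variables (G : zmodType) (k : fieldType) (A : gralg G k) (I : A -> Prop).
Variable r : retraction I.

Definition fixed_pred : {pred A} := fun x => r x == x.

Fact fixed_submod : submod_closed fixed_pred.
Proof.
split=> [|a x y]; rewrite !unfold_in ?linear0 // => /eqP rx /eqP ry.
by rewrite linearP rx ry.
Qed.

HB.instance Definition _ :=
  GRing.isSubmodClosed.Build k A fixed_pred fixed_submod.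

Inductive quot_car := QuotCar (x : A) of x \in fixed_pred.
Definition quot_val (u : quot_car) : A := let: QuotCar x _ := u in x.

HB.instance Definition _ := [isSub for quot_val].
HB.instance Definition _ := [Choice of quot_car by <:].
HB.instance Definition _ := [SubChoice_isSubLmodule of quot_car by <:].

Fact quot_pi_subproof x : r x \in fixed_pred.
Proof. by rewrite unfold_in /fixed_pred retrK. Qed.

Definition quot_pi (x : A) : quot_car := QuotCar (quot_pi_subproof x).

Lemma quot_valK : cancel quot_val quot_pi.
Proof. by case=> x xP; apply: val_inj; apply/eqP. Qed.

Lemma retrB_ideal x : I (x - r x).
Proof. by apply/(retr_ker r); rewrite linearB /= retrK subrr. Qed.

Lemma quot_piP x y : quot_pi x = quot_pi y <-> I (x - y).
Proof.
split=> [/(congr1 val) /= rxy|/(retr_ker r)].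
  by apply/(retr_ker r); rewrite linearB /= rxy subrr.
by rewrite linearB => /eqP; rewrite subr_eq0 => /eqP ?; apply: val_inj.
Qed.

(** The difference [x - r x] lies in the two-sided ideal [I], so a factor may be replaced by its
    normal form. The ring axioms of the quotient rest on this and on [retrMr]. *)
Lemma retrMl x y : r (r x * y) = r (x * y).
Proof.
apply/esym/eqP; rewrite -subr_eq0 -linearB -mulrBl; apply/eqP/(retr_ker r).
by case: (retr_ideal r) => _ _ /(_ y _ (retrB_ideal x)) [].
Qed.

Lemma retrMr x y : r (x * r y) = r (x * y).
Proof.
apply/esym/eqP; rewrite -subr_eq0 -linearB -mulrBr; apply/eqP/(retr_ker r).
by case: (retr_ideal r) => _ _ /(_ x _ (retrB_ideal y)) [].
Qed.

Definition quot_mul (u v : quot_car) := quot_pi (val u * val v).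
Definition quot_one := quot_pi 1.

Fact quot_mulA : associative quot_mul.
Proof. by move=> u v w; apply: val_inj; rewrite /= retrMl retrMr mulrA. Qed.

Fact quot_mul1l : left_id quot_one quot_mul.
Proof.
move=> u; apply: val_inj; rewrite /= retrMl mul1r.
exact: (congr1 val (quot_valK u)).
Qed.

Fact quot_mul1r : right_id quot_one quot_mul.
Proof.
move=> u; apply: val_inj; rewrite /= retrMr mulr1.
exact: (congr1 val (quot_valK u)).
Qed.

Fact quot_mulDl : left_distributive quot_mul +%R.
Proof.
move=> u v w; apply: val_inj.
by rewrite [RHS]raddfD /= -linearD -mulrDl.
Qed.

Fact quot_mulDr : right_distributive quot_mul +%R.
Proof.
move=> u v w; apply: val_inj.
by rewrite [RHS]raddfD /= -linearD -mulrDr.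
Qed.

Fact quot_one_neq0 : quot_one != 0.
Proof.
apply/eqP => /(congr1 val); rewrite raddf0 /= => /(retr_ker r).
exact: (@retr_proper _ _ _ _ r).
Qed.

HB.instance Definition _ := GRing.Zmodule_isNzRing.Build quot_car
  quot_mulA quot_mul1l quot_mul1r quot_mulDl quot_mulDr quot_one_neq0.

Fact quot_scaleAl (a : k) (u v : quot_car) : a *: (u * v) = (a *: u) * v.
Proof.
by apply: val_inj; rewrite [LHS]linearZ /= -[RHS]/(r _) -scalerAl linearZ.
Qed.

HB.instance Definition _ :=
  GRing.Lmodule_isLalgebra.Build k quot_car quot_scaleAl.

Fact quot_scaleAr (a : k) (u v : quot_car) : a *: (u * v) = u * (a *: v).
Proof.
by apply: val_inj; rewrite [LHS]linearZ /= -[RHS]/(r _) -scalerAr linearZ.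
Qed.

HB.instance Definition _ :=
  GRing.Lalgebra_isAlgebra.Build k quot_car quot_scaleAr.

Fact quot_pi_linear : linear quot_pi.
Proof. by move=> a x y; apply: val_inj; rewrite linearP /= linearP. Qed.

HB.instance Definition _ :=
  GRing.isLinear.Build k A quot_car *:%R quot_pi quot_pi_linear.

Fact quot_pi_monoid : monoid_morphism quot_pi.
Proof.
by split=> // x y; apply: val_inj; rewrite /= retrMl retrMr.
Qed.

HB.instance Definition _ :=
  GRing.isMonoidMorphism.Build A quot_car quot_pi quot_pi_monoid.

Definition quot_part d (u : quot_car) : Prop := gr_part A d (val u).

Fact quot_part0 d : quot_part d 0.
Proof. by rewrite /quot_part raddf0; apply: gr_part0. Qed.

Fact quot_partL d (a : k) u v :
  quot_part d u -> quot_part d v -> quot_part d (a *: u + v).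
Proof. by rewrite /quot_part linearP; apply: gr_partL. Qed.

Fact quot_part1 : quot_part 0 1.
Proof. exact/retr_part/gr_part1. Qed.

Fact quot_partM d e u v :
  quot_part d u -> quot_part e v -> quot_part (d + e) (u * v).
Proof. by move=> du ev; apply/retr_part/gr_partM. Qed.

Fact quot_dec u : exists2 s : seq quot_car,
  (forall v, v \in s -> exists d, quot_part d v) & u = \sum_(v <- s) v.
Proof.
have [s sP su] := gr_dec (val u); exists [seq quot_pi x | x <- s].
  by move=> v /mapP[x /sP[d dx] ->]; exists d; apply: retr_part.
by rewrite big_map -linear_sum -su; apply/esym/quot_valK.
Qed.

Fact quot_free (s : seq G) (f : G -> quot_car) :
  uniq s -> (forall d, quot_part d (f d)) -> \sum_(d <- s) f d = 0 ->
  forall d, d \in s -> f d = 0.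
Proof.
move=> s_uniq fP f0 d ds; apply: val_inj; rewrite raddf0.
apply: (@gr_free _ _ A s (fun d => val (f d))) ds => //.
by rewrite -raddf_sum f0 raddf0.
Qed.

Definition quot : gralg G k :=
  @GrAlg G k (quot_car : algType k) quot_part
    quot_part0 quot_partL quot_part1 quot_partM quot_dec quot_free.

Definition quot_morphism : {lrmorphism A -> quot} := quot_pi.

Lemma is_quotient_quot : is_quotient quot_morphism I.
Proof.
split=> [u|x]; first by exists (val u); apply: quot_valK.
split=> [/(congr1 val)|Ix]; first by rewrite raddf0 => /(retr_ker r).
by apply: val_inj; rewrite raddf0; apply/(retr_ker r).
Qed.

End Quotient.

(** Reduces the Frobenius condition to computations in [A]: a form vanishing on [I] takes the same
    value on [x] and on its normal form, so nondegeneracy says that only elements of [I] pair to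
    zero with everything. *)
Lemma graded_frobenius_quot (k : fieldType) (A : gralg int k) (I : A -> Prop)
    (r : retraction I) (c : int) (eps : {linear A -> k^o}) :
  (exists m, dim_is (fun _ : quot r => True) m) ->
  (forall x, I x -> eps x = 0) ->
  (forall d x, gr_part A d x -> d <> c -> eps x = 0) ->
  (forall x, (forall y, eps (x * y) = 0) -> I x) ->
  (forall y, (forall x, eps (x * y) = 0) -> I y) ->
  graded_frobenius (quot r).
Proof.
move=> fdim epsI epsc epsl epsr; split=> //.
have eps_lin : linear (fun u : quot r => eps (val u)).
  by move=> a u v; rewrite !linearP.
pose lin := GRing.isLinear.Build k (quot r) k^o *:%R _ eps_lin.
pose eps' : {linear quot r -> k^o} := HB.pack (fun u : quot r => eps (val u)) lin.
have eps'E x : eps' (quot_pi r x) = eps x.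
  rewrite /= -[RHS]subr0 -(epsI _ (retrB_ideal r x)) linearB /=.
  by rewrite opprB addrC subrK.
exists c, eps'; split=> [d u||].
- exact: epsc.
- move=> u u0; rewrite -[u]quot_valK -[0](linear0 (quot_morphism r)).
  apply/quot_piP; rewrite subr0; apply: epsl => y.
  rewrite -eps'E -(u0 (quot_pi r y)) -[u in RHS]quot_valK.
  by rewrite [quot_pi r (_ * _)](rmorphM (quot_morphism r)).
- move=> u u0; rewrite -[u]quot_valK -[0](linear0 (quot_morphism r)).
  apply/quot_piP; rewrite subr0; apply: epsr => y.
  rewrite -eps'E -(u0 (quot_pi r y)) -[u in RHS]quot_valK.
  by rewrite [quot_pi r (_ * _)](rmorphM (quot_morphism r)).
Qed.

(** * Krull dimension: the upper bound *)

Fixpoint exponents (N l : nat) : seq (seq nat) :=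
  if l is l'.+1 then [seq e :: s | e <- iota 0 N, s <- exponents N l']
  else [:: [::]].

Fixpoint monomial (A : nzRingType) (xs : seq A) (s : seq nat) : A :=
  match xs, s with
  | x :: xs', e :: s' => x ^+ e * monomial xs' s'
  | _, _ => 1
  end.

Lemma size_exponents N l : size (exponents N l) = (N ^ l)%N.
Proof.
by elim: l => //= l IH; rewrite size_allpairs size_iota IH expnS.
Qed.

Lemma uniq_exponents N l : uniq (exponents N l).
Proof.
elim: l => //= l IH; apply: allpairs_uniq; rewrite ?iota_uniq //.
by move=> [e s] [e' s'] _ _ [-> ->].
Qed.

Section Ideals.
Variables (A : nzRingType) (P : A -> Prop).
Hypothesis idP : is_ideal P.

Lemma ideal0 : P 0. Proof. by case: idP. Qed.

Lemma idealD x y : P x -> P y -> P (x + y).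
Proof. by case: idP => _ D _; apply: D. Qed.

Lemma idealMl a x : P x -> P (a * x).
Proof. by case: idP => _ _ M /(M a) []. Qed.

Lemma idealMr a x : P x -> P (x * a).
Proof. by case: idP => _ _ M /(M a) []. Qed.

Lemma idealB x y : P x -> P y -> P (x - y).
Proof.
by move=> Px Py; apply: idealD => //; rewrite -mulN1r; apply: idealMl.
Qed.

Lemma ideal_sum (J : eqType) (r : seq J) (F : J -> A) :
  (forall j, j \in r -> P (F j)) -> P (\sum_(j <- r) F j).
Proof.
move=> PF; rewrite big_seq.
by apply: big_ind; [exact: ideal0|exact: idealD|].
Qed.

End Ideals.

Lemma prime_idealX (A : nzRingType) (P : A -> Prop) x e :
  prime_ideal P -> P (x ^+ e) -> P x.
Proof.
case=> _ P1 PM; elim: e => [|e IH]; first by rewrite expr0.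
by rewrite exprS => /PM[].
Qed.

(* Cancel the lowest power of x_0, which is not in P_0; the lowest coefficient
   then lies in P_1, since x_0 does, and one proceeds with x_1, ... *)
Lemma prime_chain_free (k : fieldType) (A : algType k) (xs : seq A)
    (P : nat -> A -> Prop) (N : nat) (c : seq nat -> k) :
  (forall i, (i <= size xs)%N -> prime_ideal (P i)) ->
  (forall i, (i < size xs)%N ->
     [/\ forall x, P i x -> P i.+1 x, P i.+1 xs`_i & ~ P i xs`_i]) ->
  P 0%N (\sum_(s <- exponents N (size xs)) c s *: monomial xs s) ->
  forall s, s \in exponents N (size xs) -> c s = 0.
Proof.
elim: xs P c => [|x xs IH] P c Pprime Pchain /=.
  rewrite big_seq1 /= => Pc s; rewrite inE => /eqP ->; apply/eqP.
  apply: contra_notT (_ : ~ P 0%N 1) => [c0|].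
    rewrite -[1](scale1r 1) -(mulVf c0) -scalerA -[c _ *: 1]mul1r scalerAl.
    by apply: idealMl => //; case: (Pprime 0%N).
  by case: (Pprime 0%N).
pose S e := \sum_(s <- exponents N (size xs)) c (e :: s) *: monomial xs s.
have id0 : is_ideal (P 0%N) by case: (Pprime 0%N).
have id1 : is_ideal (P 1%N) by case: (Pprime 1%N).
have [P01 P1x P0x] := Pchain 0%N isT.
have S0 e : P 1%N (S e) -> forall s, s \in exponents N (size xs) -> c (e :: s) = 0.
  move=> PS; apply: (IH (fun i => P i.+1) (fun s => c (e :: s))) => // i ilt.
  - exact: (Pprime i.+1).
  - exact: (Pchain i.+1).
(* Induction on the number [M] of powers still present: once the lowest coefficient [S e0] is known
   to vanish, the sum restarts at [e0.+1]. *)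
suff main e0 M : P 0%N (\sum_(e <- iota e0 M) x ^+ e * S e) ->
    forall e, e \in iota e0 M -> P 1%N (S e).
  move=> PS t /allpairsP[[e s] /= [eN sN ->]]; apply: (S0 e) => //.
  apply: (main 0%N N) => //; move: PS; rewrite big_allpairs_dep.
  congr (P 0%N _); apply: eq_bigr => f _; rewrite mulr_sumr.
  by apply: eq_bigr => u _ /=; rewrite scalerAr.
elim: M e0 => [|M IHM] e0 //= PS.
have Pe0 : P 1%N (S e0).
  have : P 0%N (x ^+ e0 *
      (S e0 + x * \sum_(e <- iota e0.+1 M) x ^+ (e - e0.+1) * S e)).
    move: PS; rewrite big_cons mulrDr; congr (P 0%N (_ + _)).
    rewrite mulrA -exprSr mulr_sumr; apply: eq_big_seq => e /=.
    rewrite mem_iota => /andP[e0e _].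
    by rewrite mulrA -exprD subnKC.
  case: (Pprime 0%N) => // _ _ /[apply] -[|/P01 PS1].
    by move/(prime_idealX (Pprime 0%N isT)).
  rewrite -[S e0](addrK (x * \sum_(e <- iota e0.+1 M) x ^+ (e - e0.+1) * S e)).
  by apply: idealB => //; apply: idealMr.
move=> e; rewrite inE => /orP[/eqP -> //|]; apply: IHM.
suff Se0 : S e0 = 0 by move: PS; rewrite big_cons Se0 mulr0 add0r.
by rewrite /S big_seq big1 // => s /(S0 _ Pe0) ->; rewrite scale0r.
Qed.

(** A matrix with more rows than columns has a nonzero left kernel. *)
Lemma linear_dependence (k : fieldType) (I J : finType) (F : I -> J -> k) :
  (#|J| < #|I|)%N ->
  exists2 c : I -> k, exists i, c i != 0 & forall j, \sum_i c i * F i j = 0.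
Proof.
move=> JI; pose M := \matrix_(i < #|I|, j < #|J|) F (enum_val i) (enum_val j).
have : kermx M != 0.
  rewrite -mxrank_eq0 mxrank_ker -lt0n subn_gt0.
  exact: leq_ltn_trans (rank_leq_col M) JI.
case/rowV0Pn=> v /sub_kermxP vM /eqP v0.
exists (fun i => v 0 (enum_rank i)).
  apply/existsP; apply: contra_notT v0; rewrite negb_exists => /forallP v0.
  apply/rowP => i; rewrite mxE; apply/eqP.
  by have := v0 (enum_val i); rewrite negbK enum_valK.
move=> j; have := congr1 (fun N : 'rV_#|J| => N 0 (enum_rank j)) vM.
rewrite !mxE => vMj; rewrite -[RHS]vMj.
rewrite (reindex_onto enum_val enum_rank) => [|i _]; last exact: enum_rankK.
rewrite (eq_bigl xpredT) => [|i]; last by rewrite enum_valK eqxx.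
by apply: eq_bigr => i _; rewrite mxE enum_valK !enum_rankK.
Qed.

Section Box.
Variables (n : nat) (k : fieldType).
Implicit Types f g : {mpoly k[n]}.

(** Each exponent is bounded separately, so that the monomials allowed by [b] number exactly
    [b.+1 ^ n]. *)
Definition box (b : nat) f := forall m, m \in msupp f -> forall i, (m i <= b)%N.

Lemma box1 : box 0 1.
Proof. by move=> m; rewrite msupp1 inE => /eqP -> i; rewrite mnm0E. Qed.

Lemma boxM b c f g : box b f -> box c g -> box (b + c) (f * g).
Proof.
move=> fb gc m /msuppM_le /allpairsP[[m1 m2] /= [/fb m1b /gc m2c ->]] i.
by rewrite mnmDE leq_add.
Qed.

Lemma boxX b f e : box b f -> box (b * e) (f ^+ e).
Proof.
move=> fb; elim: e => [|e IH]; first by rewrite muln0; apply: box1.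
by rewrite exprS mulnS; apply: boxM.
Qed.

Lemma boxW b c f : (b <= c)%N -> box b f -> box c f.
Proof. by move=> bc fb m /fb mb i; apply: leq_trans (mb i) bc. Qed.

Lemma box_msize f : box (msize f) f.
Proof.
move=> m /msize_mdeg_lt mf i; apply: leq_trans (ltnW mf).
by rewrite mdegE (bigD1 i) //= leq_addr.
Qed.

Lemma box_monomial D N (xs : seq {mpoly k[n]}) s :
  (forall x, x \in xs -> box D x) -> s \in exponents N (size xs) ->
  box (D * N * size xs) (monomial xs s).
Proof.
elim: xs s => [|x xs IH] [|e s] xsD //=; try by rewrite muln0; move=> _; exact: box1.
  by case/allpairsP => -[? ?] /= [].
case/allpairsP => -[e' s'] /= [eN sN [-> ->]]; rewrite mulnS; apply: boxM.
  apply: (boxW (b := (D * e')%N)); last by apply/boxX/xsD; rewrite inE eqxx.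
  by rewrite leq_mul2l ltnW ?orbT //; rewrite mem_iota in eN.
by apply: IH => // y yxs; apply: xsD; rewrite inE yxs orbT.
Qed.

End Box.

Lemma rmorph_monomial (A B : nzRingType) (f : {rmorphism A -> B}) xs s :
  f (monomial xs s) = monomial [seq f x | x <- xs] s.
Proof.
elim: xs s => [|x xs IH] [|e s] /=; rewrite ?rmorph1 //.
by rewrite rmorphM rmorphXn IH.
Qed.

(** If [m > n], then [n.+1] elements taken from the chain have [N ^ n.+1] independent monomials with
    exponents below [N], by [prime_chain_free]. Their images lie in a box whose size grows only like
    [N ^ n], so for large [N] some combination vanishes. *)
Lemma prime_chain_bound (k : fieldType) (A : algType k) (n m : nat)
    (phi : {lrmorphism A -> {mpoly k[n]}}) :
  injective phi -> prime_chain A m -> (m <= n)%N.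
Proof.
move=> phi_inj [P [Pprime Pchain]]; rewrite leqNgt; apply/negP => nm.
have [f fP] : exists f : nat -> A, forall i, (i < m)%N -> P i.+1 (f i) /\ ~ P i (f i).
  have [i|f fP] := @boolp.choice nat A (fun i x => (i < m)%N -> P i.+1 x /\ ~ P i x).
    case: (ltnP i m) => [im|_]; last by exists 0.
    by have [_ [x]] := Pchain i im; exists x.
  by exists f.
have [xs sxs xsE] : exists2 xs : seq A,
    size xs = n.+1 & forall i, (i < n.+1)%N -> xs`_i = f i.
  by exists (mkseq f n.+1) => [|i ilt]; rewrite ?size_mkseq ?nth_mkseq.
pose ys := [seq phi x | x <- xs].
pose D := (\sum_(y <- ys) msize y)%N.
have ysD y : y \in ys -> box D y.
  move=> yys; apply: (boxW _ (@box_msize _ _ y)).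
  by rewrite /D (big_rem y) //= leq_addr.
(* The box bound satisfies [b.+1 <= C * N], and [(C * N) ^ n < N ^ n.+1] as soon as [C ^ n < N];
   this dictates [N]. *)
pose C := (D * n.+1).+1; pose N := (C ^ n).+1; pose b := (D * N * n.+1)%N.
pose T := exponents N n.+1; have sT : size T = (N ^ n.+1)%N.
  exact: size_exponents.
pose F (i : 'I_(size T)) (j : {ffun 'I_n -> 'I_b.+1}) : k :=
  (phi (monomial xs (nth [::] T i)))@_[multinom val (j l) | l < n].
have [|c [i0 ci0] cF] := linear_dependence F.
  rewrite card_ffun !card_ord sT.
  apply: leq_ltn_trans (_ : (C * N) ^ n < _)%N.
    case: (posnP n) => [->|n0]; rewrite ?expn0 // leq_exp2r //.
    by rewrite /C mulSn addnC mulnAC -addn1 leq_add2l.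
  by rewrite expnMn expnSr mulnC ltn_mul2l expn_gt0 /N ltnS leqnn.
pose c' s : k := if insub (index s T) is Some i then c i else 0.
have c'E (i : 'I_(size T)) : c' (nth [::] T i) = c i.
  by rewrite /c' index_uniq ?uniq_exponents // valK.
suff c'0 : forall s, s \in T -> c' s = 0.
  by move: ci0; rewrite -c'E c'0 ?eqxx ?mem_nth.
rewrite /T -sxs; apply: (@prime_chain_free _ _ _ P) => [i|i|].
- by rewrite sxs => ile; apply: Pprime; apply: leq_trans nm.
- rewrite sxs => ile; have im : (i < m)%N by apply: leq_trans nm.
  have [Pi _] := Pchain i im; rewrite xsE //.
  by have [? ?] := fP i im.
rewrite (_ : \sum_(s <- _) _ = 0); first by apply: ideal0; case: (Pprime 0%N).
apply: phi_inj; rewrite linear0 linear_sum /=.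
apply/mpolyP => mo; rewrite mcoeff0 raddf_sum /=.
(* Outside the box every coefficient is zero; inside it the exponent is one of the columns of
   [F]. *)
have [mob|] := boolP [forall l, (mo l <= b)%N]; last first.
  rewrite negb_forall => /existsP[l mol]; rewrite big_seq big1 // => s sxsN.
  rewrite linearZ /= mcoeffZ rmorph_monomial memN_msupp_eq0 ?mulr0 //.
  apply: contra mol => mos; have -> : b = (D * N * size ys)%N.
    by rewrite /b size_map sxs.
  by apply: (box_monomial ysD _ mos); rewrite size_map.
have -> : mo = [multinom val ([ffun l => inord (mo l)] l : 'I_b.+1) | l < n].
  apply/mnmP => l; rewrite mnmE ffunE /= inordK // ltnS.
  exact: (forallP mob).
rewrite sxs -/T (big_nth [::]) big_mkord -[RHS](cF [ffun l => inord (mo l)]).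
by apply: eq_bigr => i _; rewrite c'E linearZ /= mcoeffZ.
Qed.

(** * Degrees of monomials *)

Lemma sum_half_pow n :
  \sum_(i < n) (2%:R ^+ i.+1)^-1 = 1 - (2%:R ^+ n)^-1 :> rat.
Proof.
elim: n => [|n IH]; first by rewrite big_ord0 expr0 invr1 subrr.
rewrite big_ord_recr /= IH exprS invfM.
by set x := (_ ^+ n)^-1; lra.
Qed.

Section Degrees.
Variables (p n : nat).
Hypothesis p_prime : prime p.
Implicit Types (i : 'I_n) (m : 'X_{1..n}).

Let p_gt0 : (0 < p)%N := prime_gt0 p_prime.
Let pR_neq0 : p%:R != 0 :> rat. Proof. by rewrite pnatr_eq0 -lt0n. Qed.

Definition ydeg (i : 'I_n) : nat := ((if p == 2 then 1 else 2) * (p ^ i.+1).-1)%N.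

Lemma ydeg_gt0 i : (0 < ydeg i)%N.
Proof.
have : (1 < p ^ i.+1)%N by rewrite -(exp1n i.+1) ltn_exp2r // prime_gt1.
by rewrite /ydeg muln_gt0; case: (p == 2) => /=; lia.
Qed.

Lemma xdegE i : xdeg p i = (ydeg i)%:R / p%:R ^+ i.+1.
Proof.
rewrite /xdeg /ydeg natrM -subn1 natrB ?expn_gt0 ?p_gt0 // natrX.
by case: eqP => [->|_]; rewrite ?mul1r.
Qed.

Lemma xdeg_mulrn i : xdeg p i *+ (p ^ i.+1) = (ydeg i)%:R.
Proof. by rewrite xdegE -[LHS]mulr_natr natrX divfK // expf_neq0. Qed.

Lemma xdeg_ge_half i : 1 / 2%:R <= xdeg p i.
Proof.
rewrite xdegE ler_pdivlMr ?exprn_gt0 ?ltr0n //.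
rewrite -natrX mulrAC mul1r ler_pdivrMr ?ltr0n // -natrM ler_nat.
have : (1 < p ^ i.+1)%N by rewrite -(exp1n i.+1) ltn_exp2r // prime_gt1.
by rewrite /ydeg; case: eqP => _; lia.
Qed.

Lemma xideg_gt0 i : p != 2%N -> 0 < xideg p i.
Proof.
move=> p2; rewrite /xideg subr_gt0 xdegE ltr_pdivlMr ?exprn_gt0 ?ltr0n //.
rewrite mul1r -natrX ltr_nat /ydeg (negPf p2).
have : (2 < p ^ i.+1)%N.
  rewrite (leq_trans (_ : 2 < p)%N) //; last by rewrite -{1}(expn1 p) leq_pexp2l.
  by rewrite ltn_neqAle eq_sym p2 prime_gt1.
lia.
Qed.

Lemma mondegB m m' : (m <= m')%MM -> mondeg p (m' - m)%MM = mondeg p m' - mondeg p m.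
Proof. by move=> mm'; rewrite -[in RHS](submK mm') mondegD addrK. Qed.

Lemma mondeg_ge m : (mdeg m)%:R / 2%:R <= mondeg p m.
Proof.
rewrite mdegE natr_sum mulr_suml; apply: ler_sum => i _.
by rewrite -[X in _ <= X]mulr_natr mulrC ler_wpM2r ?ler0n // -div1r xdeg_ge_half.
Qed.

Definition mtop : 'X_{1..n} :=
  [multinom ((p ^ i.+1).-1 - ((p == 2) && (i.+1 == n :> nat)))%N | i < n].

Lemma mtop_lt i : (mtop i < p ^ i.+1)%N.
Proof.
rewrite mnmE; have : (0 < p ^ i.+1)%N by rewrite expn_gt0 p_gt0.
by lia.
Qed.

(** Multiplying the degree by [2 ^ n] clears denominators and gives the integer [N] with weights
    [u j]. Only the last weight, [2 ^ n - 1], is odd, while [N = 2 ^ n * z] is even because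
    [n > 0]. *)
Lemma mondeg_even (z : int) m i :
  p = 2%N -> i.+1 = n -> mondeg p m = z%:~R -> ~~ odd (m i).
Proof.
move=> p2 iE mz; subst p.
pose u (j : 'I_n) := (2 ^ n - 2 ^ (n - j.+1))%N.
pose N := (\sum_j u j * m j)%N.
have uE j : (u j)%:R = 2%:R ^+ n * xdeg 2 j.
  rewrite natrB ?leq_exp2l ?leq_subr // !natrX /xdeg /= mulrA mulrBr mulr1.
  by rewrite mulrBl mulfK ?expf_neq0 // expfB_cond ?ltn_ord // pnatr_eq0 add0n.
have NE : N%:Z = 2%:Z ^+ n * z.
  apply: (@intr_inj rat); rewrite intrM -mz rmorphXn /= mulr_sumr.
  rewrite -!pmulrn natr_sum; apply: eq_bigr => j _.
  by rewrite natrM uE mulr_natr mulrnAr.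
have Nodd : odd N = odd (m i).
  rewrite /N (bigD1 i) //= oddD oddM /u iE subnn oddB ?expn_gt0 // oddX.
  have /negPf -> /= : n != 0%N by rewrite -iE.
  rewrite addbC big_mkcond /=.
  rewrite (_ : odd _ = false) //; apply: negbTE.
  elim/big_rec: _ => // j x _ xe; case: ifP => // ji.
  rewrite oddD (negPf xe) addbF oddM oddB ?leq_exp2l ?leq_subr // !oddX /=.
  have ji' : (j != i :> nat) by [].
  have /negPf -> : n != 0%N by rewrite -iE.
  have /negPf -> : (n - j.+1)%N != 0%N by have := ltn_ord j; lia.
  by [].
rewrite -Nodd; have : (2%:Z %| N%:Z)%Z by rewrite NE -iE exprS -mulrA dvdz_mulr.
by rewrite dvdzE /= dvdn2.
Qed.

(** Only the last exponent for [p = 2] needs an argument: it is even and below [2 ^ n], hence at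
    most [2 ^ n - 2]. *)
Lemma le_mtop (z : int) m : mondeg p m = z%:~R \/ p <> 2%N ->
  (forall i, (m i < p ^ i.+1)%N) -> (m <= mtop)%MM.
Proof.
move=> mz mlt; apply/mnm_lepP => i; rewrite mnmE; have := mlt i.
case: eqP => [p2|_] /=; last by lia.
case: eqP => [iE|_] /=; last by lia.
have [{}mz|//] := mz; have := mondeg_even p2 iE mz; rewrite p2 expnS.
have : (0 < 2 ^ i)%N by rewrite expn_gt0.
by move: (2 ^ i)%N (m i) => *; lia.
Qed.

Lemma ydeg_sum_ge : (n <= \sum_i ydeg i)%N.
Proof.
rewrite -[X in (X <= _)%N](card_ord n) -sum1_card.
by apply: leq_sum => i _; apply: ydeg_gt0.
Qed.

(** The degree of the socle. The truncated subtraction is exact by [ydeg_sum_ge]. *)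
Definition topdeg : nat := (\sum_i ydeg i - n)%N.

Lemma topdegE : topdeg%:R = \sum_i ((ydeg i)%:R - 1) :> rat.
Proof.
rewrite /topdeg natrB ?ydeg_sum_ge // natr_sum sumrB; congr (_ - _).
by rewrite sumr_const card_ord.
Qed.

(** The exponents [2^i - 1] give the sum of the [deg y_i - |x_i|], and lowering the last exponent
    subtracts [|x_n|] once more. The sum of the [|x_i|] is [n - 1 + 2^-n] and [|x_n| = 1 - 2^-n], so
    [n] is subtracted in total. *)
Lemma mondeg_mtop2 : p = 2%N -> mondeg p mtop = topdeg%:R.
Proof.
move=> p2; rewrite topdegE /mondeg; have -> : mtop =
    [multinom ((p ^ i.+1).-1 - (i.+1 == n :> nat))%N | i < n].
  by apply/mnmP => i; rewrite !mnmE p2.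
have E i : xdeg p i = 1 - (2%:R ^+ i.+1)^-1.
  by rewrite /xdeg p2 /= mulrBl divff ?mul1r // expf_neq0.
have n_sum : \sum_(i < n) xdeg p i + \sum_(i < n) xdeg p i *+ (i.+1 == n) =
    n%:R.
  have -> : \sum_(i < n) xdeg p i = \sum_(i < n) (1 - (2%:R ^+ i.+1)^-1).
    by apply: eq_bigr => i _; apply: E.
  rewrite sumrB sum_half_pow sumr_const card_ord.
  case: n E => [|n'] E; first by rewrite big_ord0 expr0 invr1 mulr0n; lra.
  rewrite big_ord_recr /= big1 => [|i _]; last first.
    by rewrite eqSS ltn_eqF.
  by rewrite E add0r eqxx mulr1n subrK.
rewrite sumrB sumr_const card_ord -n_sum opprD addrA -!sumrB.
apply: eq_bigr => i _; rewrite mnmE -xdeg_mulrn -subn1.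
have p1 : (1 < p ^ i.+1)%N by rewrite -(exp1n i.+1) ltn_exp2r // prime_gt1.
rewrite !mulrnBr ?mulr1n //; first exact: ltnW.
by lia.
Qed.

(** Index by index: [x_i^(p^i - 1)] contributes [deg y_i - |x_i|] and [xi_i] contributes
    [|x_i| - 1]. *)
Lemma mondeg_mtop_odd : p <> 2%N -> mondeg p mtop + setdeg p [set: 'I_n] = topdeg%:R.
Proof.
move=> /eqP/negPf p2; rewrite topdegE /mondeg /setdeg.
rewrite [X in _ + X](eq_bigl xpredT) => [|i]; last by rewrite inE.
rewrite -big_split; apply: eq_bigr => i _; rewrite mnmE p2 /= subn0 -subn1.
rewrite mulrnBr ?expn_gt0 ?p_gt0 // xdeg_mulrn mulr1n /xideg.
by rewrite addrA subrK.
Qed.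

End Degrees.

(** * Krull dimension of the integral part of a polynomial ring *)

Lemma mpoly_linear_ext (k : fieldType) (n : nat) (V : lmodType k)
    (g h : {linear {mpoly k[n]} -> V}) :
  (forall m, g 'X_[m] = h 'X_[m]) -> g =1 h.
Proof.
move=> gh f; rewrite [f]mpolyE !linear_sum; apply: eq_bigr => m _.
by rewrite !linearZ gh.
Qed.

Section Vanishing.
Variables (k : fieldType) (n : nat).

(** Substitutes zero for the first [i] variables. The kernels of these maps on the integral part
    form a chain of primes of length [n]. *)
Definition vanish (i : nat) : {lrmorphism {mpoly k[n]} -> {mpoly k[n]}} :=
  comp_mpoly [tuple (if (j < i)%N then 0 else 'X_j) | j < n].

Lemma vanishX i (m : 'X_{1..n}) :
  vanish i 'X_[m] = \prod_(j < n) (if (j < i)%N then 0 else 'X_j) ^+ m j.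
Proof.
by rewrite /= comp_mpolyX; apply: eq_bigr => j _; rewrite tnth_mktuple.
Qed.

Lemma vanishXn i (j : 'I_n) e : (0 < e)%N ->
  vanish i ('X_j ^+ e) = if (j < i)%N then 0 else 'X_j ^+ e.
Proof.
move=> e0; rewrite rmorphXn /= comp_mpolyXU -tnth_nth tnth_mktuple.
by case: ifP; rewrite // expr0n eqn0Ngt e0.
Qed.

Lemma vanish_vanish i j f : (i <= j)%N -> vanish j (vanish i f) = vanish j f.
Proof.
move=> ij; apply: (mpoly_linear_ext (g := vanish j \o vanish i)) => m.
rewrite -[LHS]/(vanish j (vanish i _)) vanishX rmorph_prod [RHS]vanishX.
apply: eq_bigr => l _; rewrite rmorphXn; congr (_ ^+ _) => /=.
case: (ltnP l i) => li; first by rewrite linear0 (leq_trans li ij).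
by rewrite -['X_l]expr1 vanishXn.
Qed.

End Vanishing.
Arguments vanish {k n} i.

Section Inclusion.
Variables (k : fieldType) (R : gralg rat k).

Definition Int_incl_linear : {linear Int_car R -> R} := (val : Int_car R -> R).
Definition Int_incl_rmorphism : {rmorphism Int_car R -> R} :=
  (val : Int_car R -> R).
Definition Int_incl : {lrmorphism Int R -> R} :=
  HB.pack (val : Int_car R -> R)
    (GRing.Linear.on Int_incl_linear) (GRing.RMorphism.on Int_incl_rmorphism).

End Inclusion.

Lemma prime_ideal_ker (A : nzRingType) (B : idomainType)
    (f : {rmorphism A -> B}) : prime_ideal (fun x => f x = 0).
Proof.
split=> [|/eqP|x y /eqP]; last 1 first.
- by rewrite rmorphM mulf_eq0 => /orP[]/eqP; [left|right].
- split=> [|x y x0 y0|a x x0]; first exact: rmorph0.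
    by rewrite rmorphD x0 y0 addr0.
  by rewrite !rmorphM x0 mulr0 mul0r.
- by rewrite rmorph1 oner_eq0.
Qed.

(** The upper bound comes from the inclusion in the polynomial ring, the lower one from the kernels
    of [vanish i]. For odd [p] this computes the dimension of the quotient by the nilpotents. *)
Lemma com_krull_dim_Int_polyR (k : fieldType) (n p : nat) :
  prime p -> com_krull_dim (Int (polyR k n p)) n.
Proof.
move=> p_prime; pose phi : {lrmorphism Int (polyR k n p) -> {mpoly k[n]}} :=
  Int_incl (polyR k n p).
have phi_inj : injective phi by apply: val_inj.
split=> [|m]; last exact: prime_chain_bound phi_inj.
exists (fun i u => vanish i (phi u) = 0); split=> [i ile|i ilt].
  exact: (prime_ideal_ker (vanish i \o phi)).
split=> [x x0|]; first by rewrite -(@vanish_vanish _ _ i) // x0 linear0.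
pose j : 'I_n := Ordinal ilt; pose e := (p ^ j.+1)%N.
have e0 : (0 < e)%N by rewrite expn_gt0 prime_gt0.
(* This power has the integral degree [ydeg p j]; it is killed by [vanish i.+1] but not by
   [vanish i], so it separates the two kernels. *)
pose y : {mpoly k[n]} := 'X_[U_(j) *+ e].
have yP : y \in @int_pred k (polyR k n p).
  apply: (@int_pred_part k (polyR k n p) (ydeg p j)) => m.
  rewrite msuppX inE => /eqP ->; rewrite -pmulrn -xdeg_mulrn //.
  rewrite /mondeg (bigD1 j) //= big1 => [|l lj]; rewrite mulmnE mnm1E.
    by rewrite eqxx mul1n addr0.
  by rewrite eq_sym (negPf lj).
exists (@IntCar k (polyR k n p) y yP); rewrite -[phi _]/y /y -mpolyXn vanishXn //.
  by rewrite leqnn.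
by rewrite ltnn => /eqP; rewrite expf_eq0 e0 -msupp_eq0 msuppX.
Qed.

(** * Palindromic rational functions *)

(** The cancellation closing [ratio_at_palindrome], with [a = q^top], [b = q^n], [s] the sign, [x]
    the numerator and [w] the inverse of the denominator at [q]. *)
Lemma palindrome_arith (F : fieldType) (a b s x w : F) : a != 0 ->
  a^-1 * x * (s * (a * b) * w) = s * b * (x * w).
Proof. by move=> a0; field. Qed.

Lemma qvar_neq0 : qvar != 0.
Proof. by rewrite tofrac_eq0 polyX_eq0. Qed.

(** Symmetry of the coefficients gives [P(1/q) = q^-top P(q)], and each factor satisfies
    [1 - q^-D = - q^-D (1 - q^D)]. The exponents leave [q^n] because the [D i] sum to [top + n]. *)
Lemma ratio_at_palindrome (n top : nat) (c : nat -> rat) (D : 'I_n -> nat) :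
  (forall d, (d <= top)%N -> c (top - d)%N = c d) ->
  (\sum_i D i = top + n)%N ->
  let P := \poly_(d < top.+1) c d in let Q := \prod_i (1 - 'X^(D i)) in
  ratio_at P Q qvar^-1 = (- qvar) ^+ n * ratio_at P Q qvar.
Proof.
move=> c_sym D_sum P Q; have q0 := qvar_neq0; set q := qvar in q0 *.
pose iota : {rmorphism rat -> {fraction {poly rat}}} :=
  @tofrac {poly rat} \o polyC.
rewrite /ratio_at -/q -[fun _ => _]/(iota : _ -> _).
have QE x : (map_poly iota Q).[x] = \prod_i (1 - x ^+ D i).
  rewrite rmorph_prod horner_prod; apply: eq_bigr => i _.
  by rewrite rmorphB rmorph1 [X in _ - X]map_polyXn !hornerE.
have PE x : (map_poly iota P).[x] = \sum_(d < top.+1) iota (c d) * x ^+ d.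
  rewrite /P poly_def rmorph_sum horner_sum; apply: eq_bigr => d _.
  rewrite -mul_polyC rmorphM [X in X * _]map_polyC [X in _ * X]map_polyXn.
  by rewrite !hornerE.
have Pinv : (map_poly iota P).[q^-1] = (q ^+ top)^-1 * (map_poly iota P).[q].
  rewrite !PE mulr_sumr (reindex_inj rev_ord_inj); apply: eq_bigr => d _ /=.
  have dt : (d <= top)%N by rewrite -ltnS.
  rewrite subSS c_sym // mulrCA; congr (_ * _).
  by rewrite exprVn -[in q ^+ top](subnK dt) exprD invfM mulfVK ?expf_neq0.
have Qinv : (map_poly iota Q).[q^-1] =
    (-1) ^+ n * (q ^+ (top + n))^-1 * (map_poly iota Q).[q].
  have -> : (-1) ^+ n = \prod_(i < n) (-1) :> {fraction {poly rat}}.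
    by rewrite prodr_const card_ord.
  rewrite !QE -D_sum -prodrXr -prodfV -!big_split.
  apply: eq_bigr => i _ /=; rewrite exprVn mulN1r mulrBr mulr1 mulNr mulVf ?expf_neq0 //.
  by rewrite opprK addrC.
have qt : q ^+ top != 0 by rewrite expf_neq0.
rewrite Pinv Qinv !invfM invrK -[((-1) ^+ n)^-1]exprVn invrN1 [(- q) ^+ n]exprNn exprD.
exact: palindrome_arith.
Qed.

(** * Algebras with a homogeneous monomial basis *)

Section DualBasis.
Variables (k : fieldType) (A : algType k) (M : eqType) (L : seq M).
Variables (b : M -> A) (coord : M -> {linear A -> k^o}) (V : A -> Prop).

(** The functionals [coord] are dual to the family [b]: expansion along them gives existence of
    coordinates, applying them gives uniqueness. *)
Lemma dim_is_dual_basis : uniq L ->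
  (forall z, z \in L -> V (b z)) ->
  (forall z z', z \in L -> z' \in L -> coord z (b z') = (z == z')%:R) ->
  (forall x, V x -> x = \sum_(z <- L) coord z x *: b z) ->
  dim_is V (size L).
Proof.
(* The empty list is treated apart because [nth] requires a default element of [M]. *)
move=> L_uniq Vb cb Vx; case: (posnP (size L)) => [L0|].
  rewrite L0; exists (fun _ => 0) => [[]//|x /Vx ->].
  rewrite (size0nil L0) big_nil; exists 0; split=> [|c _]; rewrite ?big_ord0 //.
  by apply/rowP => -[].
case: L L_uniq Vb cb Vx => // z0 L' L_uniq Vb cb Vx _.
set l := z0 :: L' in L_uniq Vb cb Vx *.
exists (fun i => b (nth z0 l i)) => [i|x /Vx xE]; first exact/Vb/mem_nth.
have sumE (c : M -> k) :
    \sum_(z <- l) c z *: b z = \sum_(i < size l) c (nth z0 l i) *: b (nth z0 l i).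
  by rewrite (big_nth z0) big_mkord.
exists (\row_i coord (nth z0 l i) x); split=> [|c cE].
  by rewrite {1}xE sumE; apply: eq_bigr => i _; rewrite mxE.
apply/rowP => j; rewrite mxE cE linear_sum (bigD1 j) //= big1 => [|i ij].
  by rewrite addr0 linearZ /= cb ?mem_nth // eqxx [_ *: _]mulr1.
rewrite linearZ /= cb ?mem_nth // nth_uniq //.
by rewrite [in X in X%:R](inj_eq val_inj) eq_sym (negPf ij) scaler0.
Qed.

End DualBasis.

Section Subalgebras.
Variables (k : fieldType) (A : algType k).
Implicit Types (s t : seq A) (B : A -> Prop).

Lemma gen_subalg_is_subalg s : is_subalg (gen_subalg s).
Proof.
split=> [B [] //|a x y sx sy B BP sB|x y sx sy B BP sB]; case: (BP) => _ BL BM.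
  by apply: BL; [apply: sx|apply: sy].
by apply: BM; [apply: sx|apply: sy].
Qed.

Lemma mem_gen_subalg s x : x \in s -> gen_subalg s x.
Proof. by move=> xs B _; apply. Qed.

Lemma is_subalg0 B : is_subalg B -> B 0.
Proof.
by case=> B1 BL _; rewrite -(addNr 1) -[- 1]scaleN1r; apply: BL.
Qed.

Lemma is_subalgD B x y : is_subalg B -> B x -> B y -> B (x + y).
Proof. by case=> _ BL _ Bx By; rewrite -[x]scale1r; apply: BL. Qed.

Lemma module_finite_generated s : module_finite_over s -> finitely_generated A.
Proof.
case=> t tP; exists (s ++ t) => x B BP stB; have [c cP ->] := tP x.
apply: big_ind => [|y z By Bz|i _]; first exact: is_subalg0.
  exact: is_subalgD.
case: (BP) => _ _ BM; apply: BM; last by apply: stB; rewrite mem_cat mem_nth ?orbT.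
by apply: (cP i) => // y ys; apply: stB; rewrite mem_cat ys.
Qed.

End Subalgebras.

Lemma gen_ideal_is_ideal (A : nzRingType) (s : seq A) : is_ideal (gen_ideal s).
Proof.
split=> [I [] //|x y sx sy I IP sI|a x sx]; first by apply: idealD; [|apply: sx|apply: sy].
by split=> I IP sI; [apply: idealMl|apply: idealMr] => //; apply: sx.
Qed.

Lemma mem_gen_ideal (A : nzRingType) (s : seq A) x : x \in s -> gen_ideal s x.
Proof. by move=> xs I _; apply. Qed.

(* R is free over k[x_1, ..., x_n], with a homogeneous basis e_t indexed by T:
   mb_mk f t stands for f * e_t, mb_coef t for the coordinate on e_t and mb_str
   for the structure constants, which lie in k.  The last fields say that
   mtop * e_(mb_dual mb_one) spans the socle of Int(R) modulo the
   x_i ^ (p ^ i). *)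
Record monomial_basis (k : fieldType) (n p : nat) (R : gralg rat k)
    (T : finType) := MonomialBasis {
  mb_coef : T -> {linear R -> {mpoly k[n]}};
  mb_mk : {mpoly k[n]} -> T -> R;
  mb_mkK : forall f t u, mb_coef u (mb_mk f t) = if u == t then f else 0;
  mb_inj : forall x y, (forall t, mb_coef t x = mb_coef t y) -> x = y;
  mb_one : T;
  mb_mk1 : mb_mk 1 mb_one = 1;
  mb_str : T -> T -> T -> k;
  mb_mul : forall x y u, mb_coef u (x * y) =
    \sum_t \sum_t' mb_str t t' u *: (mb_coef t x * mb_coef t' y);
  mb_str1l : forall t u, mb_str mb_one t u = (t == u)%:R;
  mb_deg : T -> rat;
  mb_deg_ge0 : forall t, 0 <= mb_deg t;
  mb_part : forall d x, gr_part R d x <->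
    forall t, poly_part p (d - mb_deg t) (mb_coef t x);
  mb_dual : T -> T;
  mb_dualK : involutive mb_dual;
  mb_str_dual : forall t u, (mb_str t u (mb_dual mb_one) != 0) = (u == mb_dual t);
  mb_deg_dual : forall t,
    mb_deg t + mb_deg (mb_dual t) = mb_deg (mb_dual mb_one);
  mb_deg_top : mondeg p (mtop p n) + mb_deg (mb_dual mb_one) = (topdeg p n)%:R;
  mb_le_top : forall (z : int) m t, mondeg p m + mb_deg t = z%:~R ->
    (forall i : 'I_n, (m i < p ^ i.+1)%N) -> (m <= mtop p n)%MM
}.

Section MonomialBasis.
Variables (k : fieldType) (n p : nat) (R : gralg rat k) (T : finType).
Hypothesis p_prime : prime p.
Variable B : monomial_basis n p R T.

Local Notation M := ('X_{1..n} * T)%type.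
Local Notation E := (Int R).
Local Notation one := (mb_one B).
Local Notation dual := (mb_dual B).
Local Notation coef := (mb_coef B).
Implicit Types (z : M) (u : E) (i j : 'I_n) (m : 'X_{1..n}) (t : T).

(** * Weights, coordinates and the monomial basis of Int(R) *)

Definition wt z : rat := mondeg p z.1 + mb_deg B z.2.

Definition wt_int z : bool := wt z \is a Num.int.

Lemma deg_one : mb_deg B one = 0.
Proof. by have := mb_deg_dual B one; move/(canRL (addrK _)); rewrite subrr. Qed.

Lemma wt_ge z : (mdeg z.1)%:R / 2%:R <= wt z.
Proof.
apply: le_trans (mondeg_ge p_prime z.1) _.
by rewrite lerDl mb_deg_ge0.
Qed.

Lemma wtD m m' t : wt ((m + m')%MM, t) = mondeg p m + wt (m', t).
Proof. by rewrite /wt /= mondegD addrA. Qed.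

Definition ymon i : 'X_{1..n} := (U_(i) *+ (p ^ i.+1))%MM.

Lemma mondeg_ymon i : mondeg p (ymon i) = (ydeg p i)%:R.
Proof.
rewrite /mondeg (bigD1 i) //= big1 => [|l li]; rewrite mulmnE mnm1E.
  by rewrite eqxx mul1n addr0 xdeg_mulrn.
by rewrite eq_sym (negPf li).
Qed.

Lemma ymon_le i m : (p ^ i.+1 <= m i)%N -> (ymon i <= m)%MM.
Proof.
move=> im; apply/mnm_lepP => j; rewrite mulmnE mnm1E.
by case: eqP => [<-|_]; rewrite ?mul1n.
Qed.

Definition mono z : R := mb_mk B 'X_[z.1] z.2.

Lemma coef_mono z t : coef t (mono z) = if t == z.2 then 'X_[z.1] else 0.
Proof. exact: mb_mkK. Qed.

Lemma mono_part z : gr_part R (wt z) (mono z).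
Proof.
apply/(mb_part B) => t m; rewrite coef_mono; case: eqP => [->|_].
  by rewrite msuppX inE => /eqP ->; rewrite addrK.
by rewrite msupp0.
Qed.

Lemma mono_int z : wt_int z -> mono z \in @int_pred k R.
Proof.
case/intrP => d dE; apply: (@int_pred_part _ _ d).
by rewrite -dE; apply: mono_part.
Qed.

Lemma coef_int (x : R) t m :
  x \in @int_pred k R -> m \in msupp (coef t x) -> wt_int (m, t).
Proof.
case/int_predP => s sP ->; rewrite raddf_sum /= => /msupp_sum_le.
case/flattenP => l /mapP[y]; rewrite filter_predT => /sP[d /(mb_part B) dy] -> /dy md.
by rewrite /wt_int /wt /= md subrK intr_int.
Qed.

Definition co z (u : E) : k^o := (coef z.2 (val u))@_z.1.

Fact co_linear z : linear (co z).
Proof. by move=> a u v; rewrite /co (linearP (Int_incl R)) !linearP. Qed.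

HB.instance Definition _ z := GRing.isLinear.Build k E k^o *:%R (co z) (co_linear z).

Lemma coE z u : co z u = (coef z.2 (val u))@_z.1. Proof. by []. Qed.

(** Made total by a default: the value is [mono z] when the weight of [z] is integral and zero
    otherwise. *)
Definition mkE z : E := insubd (0 : Int_car R) (mono z).

Lemma val_mkE z : wt_int z -> val (mkE z) = mono z.
Proof. by move=> zi; rewrite val_insubd mono_int. Qed.

Lemma co_int z u : co z u != 0 -> wt_int z.
Proof.
case: z => m t; rewrite coE -mcoeff_msupp /=.
exact/coef_int/valP.
Qed.

Lemma co_mkE z z' : wt_int z' -> co z (mkE z') = (z == z')%:R.
Proof.
move=> zi; rewrite coE val_mkE // coef_mono; case: z z' {zi} => [m t] [m' t'] /=.
rewrite xpair_eqE andbC; case: eqP => _ /=; last by rewrite mcoeff0.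
by rewrite mcoeffX eq_sym.
Qed.

Lemma coP u v : (forall z, co z u = co z v) -> u = v.
Proof.
move=> uv; apply: val_inj; apply: (@mb_inj _ _ _ _ _ B) => t; apply/mpolyP => m.
exact: (uv (m, t)).
Qed.

Lemma co_sum z (L : seq M) (a : M -> k) : uniq L -> all wt_int L ->
  co z (\sum_(z' <- L) a z' *: mkE z') = if z \in L then a z else 0.
Proof.
move=> L_uniq /allP Li; rewrite linear_sum /= big_seq.
under eq_bigr => z' z'L do rewrite linearZ /= co_mkE ?Li //.
case: ifP => zL.
  rewrite -big_seq (bigD1_seq z) //= eqxx big1 ?addr0 => [|z' z'z].
    by rewrite [_ *: _]mulr1.
  by rewrite eq_sym (negPf z'z) scaler0.
apply: big1 => z' z'L; case: eqP => [zz'|_]; last by rewrite scaler0.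
by rewrite zz' z'L in zL.
Qed.

Definition supp u : seq M :=
  [seq (m, t) | t <- enum T, m <- msupp (coef t (val u))].

Lemma mem_supp z u : (z \in supp u) = (co z u != 0).
Proof.
apply/allpairsPdep/idP => [[t [m [_ mu ->]]]|zu].
  by rewrite coE -mcoeff_msupp.
exists z.2, z.1; rewrite mem_enum mcoeff_msupp -coE; split=> //.
by case: z {zu}.
Qed.

Lemma supp_uniq u : uniq (supp u).
Proof.
apply: allpairs_uniq_dep; rewrite ?enum_uniq //.
by move=> [t m] [t' m'] _ _ /= [-> ->].
Qed.

Lemma supp_int u : all wt_int (supp u).
Proof. by apply/allP => z; rewrite mem_supp => /co_int. Qed.

Lemma E_expand u : u = \sum_(z <- supp u) co z u *: mkE z.
Proof.
apply: coP => z; rewrite co_sum ?supp_uniq ?supp_int //.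
by rewrite mem_supp; case: eqP.
Qed.

Lemma E_part d u :
  gr_part E d u <-> forall z, co z u != 0 -> wt z = d%:~R.
Proof.
split=> [/(mb_part B) du [m t]|du]; last apply/(mb_part B) => t m.
  by rewrite coE -mcoeff_msupp => /du; rewrite /wt /= => ->; rewrite subrK.
by rewrite mcoeff_msupp => /(du (m, t)) <-; rewrite /wt addrK.
Qed.

Lemma mkE_part d z : wt z = d%:~R -> gr_part E d (mkE z).
Proof.
move=> zd; apply/E_part => z'; rewrite co_mkE; last by rewrite /wt_int zd intr_int.
by case: (eqVneq z' z) => [->|_]; rewrite ?eqxx.
Qed.

Lemma coef_mkl f x t :
  coef t (mb_mk B f one * x) = f * coef t x.
Proof.
rewrite mb_mul (bigD1 one) //= mb_mkK eqxx [X in _ + X]big1 => [|u u1].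
  rewrite addr0 (bigD1 t) //= mb_str1l eqxx scale1r big1 ?addr0 // => u ut.
  by rewrite mb_str1l (negPf ut) scale0r.
by rewrite big1 // => v _; rewrite mb_mkK (negPf u1) mul0r scaler0.
Qed.

Lemma mono_mul m z : mono (m, one) * mono z = mono ((m + z.1)%MM, z.2).
Proof.
apply: (@mb_inj _ _ _ _ _ B) => t; rewrite coef_mkl !coef_mono /=.
by case: eqP; rewrite ?mulr0 // mpolyXD.
Qed.

Lemma wt_int_addl m z : mondeg p m \is a Num.int ->
  wt_int ((m + z.1)%MM, z.2) = wt_int z.
Proof.
by case: z => m' t mi; rewrite /wt_int wtD /= rpredDl.
Qed.

Lemma wt_one m : wt (m, one) = mondeg p m.
Proof. by rewrite /wt deg_one addr0. Qed.

Lemma mkE_mul m z : mondeg p m \is a Num.int -> wt_int z ->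
  mkE (m, one) * mkE z = mkE ((m + z.1)%MM, z.2).
Proof.
move=> mi zi; apply: val_inj; rewrite rmorphM /= !val_mkE //.
- exact: mono_mul.
- by rewrite wt_int_addl.
- by rewrite /wt_int wt_one.
Qed.

Lemma mkE0 : mkE (0%MM, one) = 1.
Proof.
apply: val_inj; rewrite val_mkE; last by rewrite /wt_int wt_one mondeg0.
by rewrite rmorph1 /mono /= mpolyX0 mb_mk1.
Qed.

(** * The parameters y_i and finiteness over them *)

Definition ygen i : E := mkE (ymon i, one).

Lemma ymon_int i : mondeg p (ymon i) \is a Num.int.
Proof. by rewrite mondeg_ymon pmulrn intr_int. Qed.

Lemma ygen_part i : gr_part E (ydeg p i) (ygen i).
Proof. by apply: mkE_part; rewrite wt_one mondeg_ymon pmulrn. Qed.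

Lemma coef_ygen i u t : coef t (val (ygen i * u)) = 'X_[ymon i] * coef t (val u).
Proof.
rewrite rmorphM /= val_mkE ?coef_mkl //.
by rewrite /wt_int wt_one ymon_int.
Qed.

Definition residual z : bool := [forall i : 'I_n, z.1 i < p ^ i.+1]%N.

Lemma mkE_factor m t i : wt_int (m, t) -> (p ^ i.+1 <= m i)%N ->
  wt_int ((m - ymon i)%MM, t) /\ mkE (m, t) = ygen i * mkE ((m - ymon i)%MM, t).
Proof.
move=> mi im; have mE : m = (ymon i + (m - ymon i))%MM.
  by rewrite addmC submK // ymon_le.
have mi' : wt_int ((m - ymon i)%MM, t).
  by rewrite -(wt_int_addl (m := ymon i)) ?ymon_int //= -mE.
by split=> //; rewrite mkE_mul ?ymon_int //= -mE.
Qed.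

Definition ygens : seq E := [seq ygen i | i <- enum 'I_n].

Lemma size_ygens : size ygens = n.
Proof. by rewrite size_map size_enum_ord. Qed.

Lemma ygen_mem i : ygen i \in ygens.
Proof. by rewrite map_f ?mem_enum. Qed.

(** Strong induction on the total degree: while some exponent reaches [p ^ i.+1], a factor [ygen i]
    splits off. *)
Lemma mkE_residual z : wt_int z -> exists2 a, gen_subalg ygens a &
  exists2 z', wt_int z' && residual z' & mkE z = a * mkE z'.
Proof.
case: z => m t; elim/ltn_ind: {m}(mdeg m) {-2}m (erefl (mdeg m)) => N IH m mN mi.
have [res|] := boolP (residual (m, t)).
  exists 1; first by case: (gen_subalg_is_subalg ygens).
  by exists (m, t); rewrite ?mi ?mul1r.
rewrite negb_forall => /existsP[i]; rewrite -leqNgt /= => im.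
have [mi' ->] := mkE_factor mi im.
have /IH/(_ _ erefl mi')[a ga [z' zi' ->]] : (mdeg (m - ymon i)%MM < N)%N.
  rewrite -mN -{2}(submK (ymon_le im)) mdegD -[X in (X < _)%N]addn0 ltn_add2l.
  by rewrite mdegMn mdeg1 mul1n expn_gt0 prime_gt0.
exists (ygen i * a); last by exists z'; rewrite ?mulrA.
case: (gen_subalg_is_subalg ygens) => _ _ gM.
by apply: gM => //; apply: mem_gen_subalg (ygen_mem i).
Qed.

(** A finite enumeration inside the infinite type [M]. In both uses the predicate [P] already forces
    the degree bound. *)
Definition bounded (b : nat) (P : pred M) : seq M :=
  [seq (bmnm w.1, w.2) | w <- enum {: 'X_{1..n < b} * T} & P (bmnm w.1, w.2)].

Lemma bounded_uniq b P : uniq (bounded b P).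
Proof.
rewrite map_inj_uniq => [|[m t] [m' t'] /= [/val_inj -> ->]] //.
exact/filter_uniq/enum_uniq.
Qed.

Lemma mem_bounded b P z :
  (z \in bounded b P) = P z && (mdeg z.1 < b)%N.
Proof.
apply/mapP/andP => [[[m t]]|[Pz zb]]; rewrite ?mem_filter /=.
  by case/andP => Pz _ -> /=; rewrite bmdeg.
case: z Pz zb => m t Pz zb; exists (BMultinom zb, t) => //.
by rewrite mem_filter /= Pz mem_enum.
Qed.

Definition socle_list : seq M :=
  bounded (mdeg (mtop p n)).+1 (fun z => wt_int z && residual z).

Lemma residual_le z : wt_int z -> residual z -> (z.1 <= mtop p n)%MM.
Proof.
case/intrP => d zd /forallP zr; exact: (mb_le_top zd zr).
Qed.

Lemma lem_mdeg (m m' : 'X_{1..n}) : (m <= m')%MM -> (mdeg m <= mdeg m')%N.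
Proof. by move=> /submK <-; rewrite mdegD leq_addl. Qed.

Lemma mem_socle_list z : (z \in socle_list) = wt_int z && residual z.
Proof.
rewrite mem_bounded andb_idr // => /andP[zi zr].
exact/lem_mdeg/residual_le.
Qed.

Lemma E_module_finite : module_finite_over ygens.
Proof.
pose t := [seq mkE z | z <- socle_list]; exists t => u.
pose W v := exists2 c : nat -> E, (forall l, gen_subalg ygens (c l)) &
  v = \sum_(i < size t) c i * t`_i.
have gP := gen_subalg_is_subalg ygens.
have W0 : W 0.
  exists (fun _ => 0) => [_|]; first exact: is_subalg0.
  by rewrite big1 // => i _; rewrite mul0r.
have WL (a : k) v w : W v -> W w -> W (a *: v + w).
  move=> [c cP ->] [d dP ->]; exists (fun l => a *: c l + d l) => [l|].
    by case: gP => _ gL _; apply: gL.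
  rewrite scaler_sumr -big_split; apply: eq_bigr => i _ /=.
  by rewrite mulrDl scalerAl.
have WM a z : gen_subalg ygens a -> wt_int z && residual z -> W (a * mkE z).
  rewrite -mem_socle_list => ga zL.
  exists (fun l => if l == index z socle_list then a else 0) => [l|].
    by case: eqP => // _; apply: is_subalg0.
  have it : (index z socle_list < size t)%N by rewrite size_map index_mem.
  rewrite (bigD1 (Ordinal it)) //= eqxx (nth_map z) ?index_mem // nth_index //.
  rewrite big1 ?addr0 // => i; rewrite -val_eqE /= => /negPf ->.
  by rewrite mul0r.
rewrite -/(W u) [u]E_expand big_seq; apply: (big_rec W) => [|z v zu Wv] //.
apply: WL => //; have [a ga [z' zi' ->]] := mkE_residual (allP (supp_int u) _ zu).
exact: WM.
Qed.

(** * Monomial ideals and regularity of the y_i *)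

Definition upward (q : pred 'X_{1..n}) := forall m m', q m -> q (m + m')%MM.

Definition supported (q : pred 'X_{1..n}) u := forall z, co z u != 0 -> q z.1.

(** Whatever the structure constants, an exponent occurring in a product is a sum of exponents
    occurring in the factors. *)
Lemma supported_ideal q : upward q -> is_ideal (supported q).
Proof.
move=> qU; have msuppZM (a : k) f g m :
    m \in msupp (a *: (f * g)) -> exists m1 m2,
      [/\ m1 \in msupp f, m2 \in msupp g & m = (m1 + m2)%MM].
  by move=> /msuppZ_le /msuppM_le /allpairsP[[m1 m2] /= []]; exists m1, m2.
have prod (u v : E) z : co z (u * v) != 0 ->
    exists z1 z2, [/\ co z1 u != 0, co z2 v != 0 & z.1 = (z1.1 + z2.1)%MM].
  rewrite coE -mcoeff_msupp rmorphM mb_mul => /msupp_sum_le.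
  case/flattenP => l /mapP[t1 _ ->] /msupp_sum_le.
  case/flattenP => {}l /mapP[t2 _ ->] /msuppZM[m1 [m2 [m1u m2v zE]]].
  by exists (m1, t1), (m2, t2); rewrite !coE -!mcoeff_msupp.
split=> [z|u v qu qv z|a u qu].
- by rewrite linear0 eqxx.
- rewrite linearD /=; case: (eqVneq (co z u) 0) => [->|/qu //].
  by rewrite add0r => /qv.
- split=> z /prod[z1 [z2 [z1a z2u ->]]]; last by apply/qU/qu.
  by rewrite addmC; apply/qU/qu.
Qed.

Definition divisible (l : nat) (m : 'X_{1..n}) : bool :=
  [exists i : 'I_n, (i < l) && (p ^ i.+1 <= m i)]%N.

Lemma divisible_upward l : upward (divisible l).
Proof.
move=> m m' /existsP[i /andP[il im]]; apply/existsP; exists i.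
by rewrite il mnmDE (leq_trans im) ?leq_addr.
Qed.

Lemma mem_take_ygens l v : v \in take l ygens <-> exists2 i : 'I_n, (i < l)%N & v = ygen i.
Proof.
rewrite -map_take; split=> [/mapP[i il ->]|[i il ->]].
  exists i => //; have := map_f val il; rewrite map_take val_enum_ord.
  by rewrite take_iota mem_iota /= add0n leq_min => /andP[].
apply: map_f; rewrite -(mem_map val_inj) map_take val_enum_ord take_iota.
by rewrite mem_iota /= add0n leq_min il ltn_ord.
Qed.

(** The elements with divisible support form an ideal containing the generators; conversely every
    monomial of such an element splits off one of the first [l] parameters by [mkE_factor]. *)
Lemma gen_ideal_ygensP l u : gen_ideal (take l ygens) u <-> supported (divisible l) u.
Proof.
split=> [|du].
  apply; first exact/supported_ideal/divisible_upward.
  move=> v /mem_take_ygens[i il ->] z.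
  rewrite co_mkE; last by rewrite /wt_int wt_one ymon_int.
  case: (eqVneq z) => [-> _|_]; last by rewrite eqxx.
  by apply/existsP; exists i; rewrite il /= mulmnE mnm1E eqxx mul1n.
have gI := gen_ideal_is_ideal (take l ygens).
rewrite [u]E_expand; apply: (ideal_sum gI) => z zu.
rewrite -mulr_algl; apply: (idealMl gI).
move: (zu); rewrite mem_supp => /du /existsP[i /andP[il im]].
case: z {du} zu im => m t zu im.
have [_ ->] := mkE_factor (allP (supp_int u) _ zu) im.
by apply: (idealMr gI); apply: mem_gen_ideal; apply/mem_take_ygens; exists i.
Qed.

Lemma not_divisible0 l : ~~ divisible l 0%MM.
Proof.
rewrite negb_exists; apply/forallP => i.
by rewrite mnm0E leqn0 expn_eq0 eqn0Ngt prime_gt0 ?andbF.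
Qed.

Lemma not_supported1 l : ~ supported (divisible l) 1.
Proof.
move=> /(_ (0%MM, one)); rewrite -mkE0 co_mkE ?eqxx; last first.
  by rewrite /wt_int wt_one mondeg0.
by rewrite oner_eq0 => /(_ isT); apply/negP/not_divisible0.
Qed.

Lemma take_ygens : take n ygens = ygens.
Proof. by rewrite take_oversize ?size_ygens. Qed.

(** Multiplication by [ygen i] translates exponents in coordinate [i] alone, so it does not affect
    divisibility by the earlier parameters. *)
Lemma ygens_regular : regular_seq ygens.
Proof.
split=> [l|]; last first.
  by rewrite -take_ygens => /gen_ideal_ygensP; apply: not_supported1.
rewrite size_ygens => ln u; pose i := Ordinal ln.
have -> : ygens`_l = ygen i.
  by rewrite (nth_map i) ?size_enum_ord // -[l]/(val i) nth_ord_enum.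
move=> /gen_ideal_ygensP lu; apply/gen_ideal_ygensP => -[m t] mu.
have /lu /existsP[j /andP[jl jm]] : co ((ymon i + m)%MM, t) (ygen i * u) != 0.
  by rewrite coE coef_ygen mulrC mcoeffMX.
apply/existsP; exists j; rewrite jl; move: jm.
by rewrite mnmDE mulmnE mnm1E -val_eqE /= gtn_eqF // mul0n add0n.
Qed.

(** * Truncation to residual monomials and the Frobenius form *)

Lemma residualE z : residual z = ~~ divisible n z.1.
Proof.
rewrite negb_exists; apply: eq_forallb => i.
by rewrite ltn_ord /= ltnNge.
Qed.

(** The normal form modulo the parameters: only residual monomials are kept. *)
Definition truncate u : E :=
  \sum_(z <- [seq z <- supp u | residual z]) co z u *: mkE z.

Lemma co_truncate z u : co z (truncate u) = if residual z then co z u else 0.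
Proof.
rewrite co_sum ?filter_uniq ?supp_uniq //; last first.
  by apply/allP => z'; rewrite mem_filter => /andP[_ /(allP (supp_int u))].
by rewrite mem_filter mem_supp; case: (residual z) => //=; case: eqP.
Qed.

Fact truncate_linear : linear truncate.
Proof.
move=> a u v; apply: coP => z; rewrite co_truncate !linearP /= !co_truncate.
by case: ifP => // _; rewrite [_ *: _]mulr0 addr0.
Qed.

HB.instance Definition _ :=
  GRing.isLinear.Build k E E *:%R truncate truncate_linear.

Lemma truncate_ker u : truncate u = 0 <-> gen_ideal ygens u.
Proof.
rewrite -take_ygens; split=> [u0|/gen_ideal_ygensP du].
  apply/gen_ideal_ygensP => z; apply: contraR; rewrite -residualE => zr.
  by have := congr1 (co z) u0; rewrite co_truncate zr linear0 => ->.
apply: coP => z; rewrite co_truncate linear0 residualE.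
case: ifP => // zd; apply/eqP; rewrite -[_ == _]negbK.
by apply: contra zd => /du.
Qed.

Definition truncation : retraction (gen_ideal ygens).
Proof.
apply: (@Retraction _ _ E _ truncate).
- exact: gen_ideal_is_ideal.
- by rewrite -take_ygens => /gen_ideal_ygensP; apply: not_supported1.
- exact: truncate_ker.
- by move=> u; apply: coP => z; rewrite !co_truncate; case: (residual z).
- move=> d u /E_part du; apply/E_part => z; rewrite co_truncate.
  by case: ifP => [_ /du //|_]; rewrite eqxx.
Defined.

Definition socle : M := (mtop p n, dual one).

Lemma wt_socle : wt socle = (topdeg p n)%:R.
Proof. exact: mb_deg_top. Qed.

Lemma wt_int_nat z d : wt z = d%:R -> wt_int z.
Proof. by rewrite /wt_int => ->; rewrite pmulrn intr_int. Qed.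

Lemma residual_socle : residual socle.
Proof. by apply/forallP => i; apply: mtop_lt. Qed.

Definition opposite z : M := ((mtop p n - z.1)%MM, dual z.2).

Lemma wt_opposite z : wt_int z -> residual z ->
  wt (opposite z) = (topdeg p n)%:R - wt z.
Proof.
move=> zi zr; rewrite -wt_socle /wt /= mondegB ?residual_le //.
by rewrite -(mb_deg_dual B z.2); ring.
Qed.

Lemma opposite_int z : wt_int z -> residual z -> wt_int (opposite z).
Proof.
move=> zi zr; rewrite /wt_int wt_opposite // rpredB //.
by rewrite pmulrn intr_int.
Qed.

Lemma opposite_residual z : residual (opposite z).
Proof.
apply/forallP => i /=; apply: leq_ltn_trans (mtop_lt _ i) => //.
by rewrite mnmBE leq_subr.
Qed.

Lemma oppositeK z : wt_int z -> residual z -> opposite (opposite z) = z.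
Proof.
move=> zi zr; have := residual_le zi zr; case: z {zi zr} => m t /= mm.
congr (_, _); last exact: mb_dualK.
apply/mnmP => i; rewrite !mnmBE subKn //; exact: (mnm_lepP mm).
Qed.

(** A product reaches the component of [dual one] only from dual pairs of indices, so a single term
    survives, and translation by [mtop - m] brings the coefficient at [m] to [mtop]. Since [R] need
    not be commutative, [coef_socle_mono] repeats this for left multiplication. *)
Lemma coef_mono_socle (x : R) m t : (m <= mtop p n)%MM ->
  (coef (dual one) (x * mono ((mtop p n - m)%MM, t)))@_(mtop p n) =
    mb_str B (dual t) t (dual one) * (coef (dual t) x)@_m.
Proof.
move=> mm; rewrite mb_mul (bigD1 (dual t)) //= [X in _ + X]big1 => [|u ut].
  rewrite addr0 (bigD1 t) //= big1 => [|u ut]; last first.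
    by rewrite coef_mono (negPf ut) mulr0 scaler0.
  by rewrite addr0 mcoeffZ coef_mono eqxx -{1}(submK mm) mcoeffMX.
apply: big1 => v _; rewrite coef_mono /=; case: eqP => [->|_]; last first.
  by rewrite mulr0 scaler0.
apply/eqP; rewrite scaler_eq0 -[X in X || _]negbK mb_str_dual.
suff /negPf -> : t != dual u by [].
by apply: contra ut => /eqP ->; rewrite mb_dualK.
Qed.

Lemma coef_socle_mono (x : R) m t : (m <= mtop p n)%MM ->
  (coef (dual one) (mono ((mtop p n - m)%MM, t) * x))@_(mtop p n) =
    mb_str B t (dual t) (dual one) * (coef (dual t) x)@_m.
Proof.
move=> mm; rewrite mb_mul (bigD1 t) //= [X in _ + X]big1 => [|u ut]; last first.
  by rewrite big1 // => v _; rewrite coef_mono (negPf ut) mul0r scaler0.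
rewrite addr0 (bigD1 (dual t)) //= big1 => [|u ut]; last first.
  apply/eqP; rewrite scaler_eq0 -[X in X || _]negbK mb_str_dual.
  by rewrite (negPf ut).
by rewrite addr0 mcoeffZ coef_mono eqxx [_ * coef _ _]mulrC -{1}(submK mm) mcoeffMX.
Qed.

Lemma quot_truncation_dim : dim_is (fun _ : quot truncation => True) (size socle_list).
Proof.
pose val' : {linear quot_car truncation -> E} := (val : quot_car truncation -> E).
pose coord z : {linear quot truncation -> k^o} := co z \o val'.
apply: (@dim_is_dual_basis _ _ _ _ (fun z => quot_pi truncation (mkE z)) coord).
- exact: bounded_uniq.
- by [].
- move=> z z'; rewrite !mem_socle_list => /andP[zi zr] /andP[zi' _].
  by rewrite -[LHS]/(co z (truncate (mkE z'))) co_truncate zr co_mkE.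
- move=> x _; rewrite -{1}[x]quot_valK.
  have {1}-> : quot_val x = \sum_(z <- socle_list) co z (val x) *: mkE z.
    apply: coP => z; rewrite co_sum ?bounded_uniq //; last first.
      by apply/allP => z'; rewrite mem_socle_list => /andP[].
    rewrite mem_socle_list; case: (boolP (wt_int z && residual z)) => // zir.
    have <- : truncate (val x) = val x := congr1 val (quot_valK x).
    rewrite co_truncate; case: ifP => // zr; apply/eqP.
    by apply: contraNT zir => /co_int ->; rewrite zr.
  by rewrite linear_sum; apply: eq_bigr => z _; rewrite linearZ.
Qed.

(** If [u] has a nonzero residual coordinate at [z], pairing [u] with the monomial [opposite z]
    returns that coordinate times a nonzero structure constant. An element pairing to zero with
    everything therefore truncates to zero. *)
Lemma quot_truncation_frobenius : graded_frobenius (quot truncation).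
Proof.
apply: (@graded_frobenius_quot _ _ _ truncation (topdeg p n) (co socle)).
- by exists (size socle_list); apply: quot_truncation_dim.
- move=> u /truncate_ker u0; have := congr1 (co socle) u0.
  by rewrite co_truncate residual_socle linear0.
- move=> d u /E_part du dtop; apply/eqP; apply: contra_notT dtop => /du.
  by rewrite wt_socle pmulrn => /intr_inj.
- move=> u u0; apply/truncate_ker/coP => z; rewrite linear0 co_truncate.
  case: ifP => // zr; apply/eqP; apply: contraT => zu.
  have zi := co_int zu; have mm := residual_le zi zr.
  have : co socle (u * mkE (opposite z)) = 0 := u0 _.
  rewrite coE rmorphM /= val_mkE ?opposite_int //.
  rewrite coef_mono_socle // mb_dualK -coE => /eqP; rewrite mulf_eq0 (negPf zu) orbF.
  by rewrite -[_ == 0]negbK mb_str_dual ?mb_dualK eqxx.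
- move=> u u0; apply/truncate_ker/coP => z; rewrite linear0 co_truncate.
  case: ifP => // zr; apply/eqP; apply: contraT => zu.
  have zi := co_int zu; have mm := residual_le zi zr.
  have : co socle (mkE (opposite z) * u) = 0 := u0 _.
  rewrite coE rmorphM /= val_mkE ?opposite_int //.
  rewrite coef_socle_mono // mb_dualK -coE => /eqP; rewrite mulf_eq0 (negPf zu) orbF.
  by rewrite -[_ == 0]negbK mb_str_dual ?mb_dualK eqxx.
Qed.

Lemma E_gorenstein : krull_dim p E n -> gorenstein p E.
Proof.
move=> Edim; exists ygens; split; last 1 first.
- exists (quot truncation), (quot_morphism truncation); split.
  + exact: is_quotient_quot.
  + by move=> d u; apply: (retr_part truncation).
  + exact: quot_truncation_frobenius.
- split; [by rewrite size_ygens| |exact: E_module_finite].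
  move=> _ /mapP[i _ ->]; exists (Posz (ydeg p i)); last exact: ygen_part.
  by rewrite ltz_nat ydeg_gt0.
- exact: ygens_regular.
Qed.

(** * The Hilbert function and the Poincare series *)

Definition level (d : nat) : seq M := bounded (2 * d).+1 (fun z => wt z == d%:R).

(** Every [x_i] has degree at least one half, so weight [d] forces total exponent at most [2 * d]
    and the cut-off in [level] loses nothing. *)
Lemma mem_level d z : (z \in level d) = (wt z == d%:R).
Proof.
rewrite mem_bounded andb_idr // => /eqP zd; have := wt_ge z.
rewrite zd ler_pdivrMr ?ltr0n // -natrM ler_nat; lia.
Qed.

Lemma level_uniq d : uniq (level d). Proof. exact: bounded_uniq. Qed.

Definition hilb (d : nat) : nat := size (level d).

Lemma poincare_hilb : poincare_coef E hilb.
Proof.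
move=> d; have Li : all wt_int (level d).
  by apply/allP => z; rewrite mem_level => /eqP /wt_int_nat.
apply: (@dim_is_dual_basis _ _ _ _ mkE (fun z => co z)).
- exact: level_uniq.
- by move=> z; rewrite mem_level => /eqP zd; apply: mkE_part; rewrite zd pmulrn.
- by move=> z z' _ z'L; rewrite /= co_mkE ?(allP Li).
- move=> u /E_part du; apply: coP => z; rewrite co_sum ?level_uniq //.
  rewrite mem_level; case: (eqVneq (wt z)) => // zd; apply/eqP.
  by apply: contraNT zd => /du ->; rewrite pmulrn.
Qed.

(** Interpolates between the residual monomials at [l = 0] and all monomials at [l = n] by freeing
    one exponent at a time; each freed exponent divides the counting series by one factor of the
    denominator. *)
Definition residual_from (l : nat) z : bool :=
  [forall i : 'I_n, (l <= i) ==> (z.1 i < p ^ i.+1)]%N.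

Definition hilb_from l d : nat := count (residual_from l) (level d).

Lemma hilb_fromE d : hilb_from n d = hilb d.
Proof.
rewrite /hilb_from /hilb -[RHS]count_predT; apply: eq_count => z /=.
by apply/forallP => i; rewrite leqNgt ltn_ord.
Qed.

Lemma residual_from0 z : residual_from 0 z = residual z.
Proof. by apply: eq_forallb => i. Qed.

Lemma residual_fromS i z :
  residual_from i z = residual_from i.+1 z && (z.1 i < p ^ i.+1)%N.
Proof.
apply/forallP/andP => [zr|[/forallP zr zi] j].
  split; last by have := zr i; rewrite leqnn.
  by apply/forallP => j; apply/implyP => /ltnW ij; have := zr j; rewrite ij.
apply/implyP; rewrite leq_eqVlt => /orP[/eqP/val_inj <- //|ij].
by have := zr j; rewrite ij.
Qed.

Definition shift i z : M := ((ymon i + z.1)%MM, z.2).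

Lemma shift_inj i : injective (shift i).
Proof.
move=> [m t] [m' t'] e; have /= -> := congr1 snd e.
by have /= /addmI -> := congr1 fst e.
Qed.

Lemma residual_from_shift i z : residual_from i.+1 (shift i z) = residual_from i.+1 z.
Proof.
apply: eq_forallb => j; case: (ltnP i j) => //= ij.
by rewrite mnmDE mulmnE mnm1E -val_eqE /= ltn_eqF // mul0n.
Qed.

Lemma level_shift i d : (ydeg p i <= d)%N ->
  perm_eq [seq z : M <- level d | ~~ (z.1 i < p ^ i.+1)%N]
    [seq shift i z | z <- level (d - ydeg p i)].
Proof.
move=> id; apply: uniq_perm; rewrite ?filter_uniq ?level_uniq //.
  by rewrite map_inj_uniq ?level_uniq //; apply: shift_inj.
move=> [m t]; rewrite mem_filter mem_level -leqNgt /=.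
apply/andP/mapP => [[im /eqP mt]|[[m' t']]].
  exists ((m - ymon i)%MM, t); last first.
    by rewrite /shift /= addmC submK // ymon_le.
  move: mt; rewrite mem_level -{1}(submK (ymon_le im)) addmC wtD mondeg_ymon.
  by rewrite natrB // => <-; rewrite addrAC subrr add0r.
rewrite mem_level natrB // => /eqP mt e; have /= -> := congr1 fst e.
have /= -> := congr1 snd e; split.
  by rewrite mnmDE mulmnE mnm1E eqxx mul1n leq_addr.
by rewrite wtD mondeg_ymon mt addrC subrK.
Qed.

Lemma level_small i d : (d < ydeg p i)%N ->
  [seq z : M <- level d | ~~ (z.1 i < p ^ i.+1)%N] = [::].
Proof.
move=> di; apply/eqP; rewrite -(negbK (_ == _)) -has_filter.
apply/hasPn => -[m t]; rewrite mem_level /= negbK ltnNge => /eqP mt.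
apply/negP => /ymon_le im; move: di; rewrite -(@ltr_nat rat) -mt.
rewrite -(submK im) addmC wtD mondeg_ymon ltNge lerDl.
by apply/negP; rewrite negbK; apply: le_trans (wt_ge _); rewrite divr_ge0.
Qed.

(** Split on whether the exponent at [i] is below [p ^ i.+1]: the monomials where it is not are
    exactly the products of [y] with monomials of weight [d - ydeg p i]. *)
Lemma hilb_from_step i d : hilb_from i.+1 d =
  (hilb_from i d + if (ydeg p i <= d)%N then hilb_from i.+1 (d - ydeg p i) else 0)%N.
Proof.
rewrite {1}/hilb_from; pose b (z : M) := (z.1 i < p ^ i.+1)%N.
have /permPl/permP/(_ (residual_from i.+1)) /= := perm_filterC b (level d).
rewrite count_cat => <-; congr (_ + _)%N.
  by rewrite count_filter; apply: eq_count => z; rewrite /= residual_fromS.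
case: leqP => [id|di]; last first.
  by rewrite (_ : filter _ _ = [::]) //; apply: level_small di.
rewrite (permP (level_shift id)).
by rewrite count_map; apply: eq_count => z; apply: residual_from_shift.
Qed.

Lemma hilb_from0_sym d : (d <= topdeg p n)%N ->
  hilb_from 0 (topdeg p n - d) = hilb_from 0 d.
Proof.
move=> dt; rewrite /hilb_from -!size_filter.
rewrite -[RHS](size_map opposite); apply: perm_size; apply: uniq_perm.
- by rewrite filter_uniq ?level_uniq.
- rewrite map_inj_in_uniq ?filter_uniq ?level_uniq // => z z'.
  rewrite !mem_filter !residual_from0 !mem_level.
  move=> /andP[zr /eqP/wt_int_nat zi] /andP[zr' /eqP/wt_int_nat zi'].
  by move=> /(congr1 opposite); rewrite !oppositeK.
- move=> z; rewrite mem_filter residual_from0 mem_level natrB //.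
  apply/andP/mapP => [[zr /eqP zd]|[z']].
    have zi : wt_int z by rewrite /wt_int zd -natrB // pmulrn intr_int.
    exists (opposite z); last by rewrite oppositeK.
    rewrite mem_filter residual_from0 opposite_residual mem_level.
    by rewrite wt_opposite // zd opprB addrC subrK eqxx.
  rewrite mem_filter residual_from0 mem_level => /andP[zr /eqP zd] ->.
  split; first exact: opposite_residual.
  by rewrite wt_opposite ?zd // (wt_int_nat zd).
Qed.

(** A residual monomial above the top degree would have an opposite of negative weight. *)
Lemma hilb_from0_top d : (topdeg p n < d)%N -> hilb_from 0 d = 0%N.
Proof.
move=> td; apply/eqP; rewrite -leqn0 leqNgt -has_count; apply/hasPn => z.
rewrite mem_level residual_from0 => /eqP zd; apply/negP => zr.
have zi := wt_int_nat zd; have := wt_ge (opposite z).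
rewrite wt_opposite // zd; apply/negP; rewrite -ltNge.
apply: (@lt_le_trans _ _ 0); first by rewrite subr_lt0 ltr_nat.
by rewrite divr_ge0.
Qed.

Definition hilb_num : {poly rat} :=
  \poly_(d < (topdeg p n).+1) (hilb_from 0 d)%:R.

Definition hilb_den : {poly rat} := \prod_(i < n) (1 - 'X^(ydeg p i)).

(** By [hilb_from_step], multiplication by [1 - q^(deg y)] undoes the freeing of one exponent.
    Cutting the series at [N > d] replaces it by a polynomial with the same coefficients up to
    [d]. *)
Lemma hilb_from_conv l N d : (l <= n)%N -> (d < N)%N ->
  ((\prod_(i < n | (i < l)%N) (1 - 'X^(ydeg p i))) *
     \poly_(e < N) (hilb_from l e)%:R)`_d = (hilb_from 0 d)%:R :> rat.
Proof.
elim: l N d => [|l IH] N d ln dN.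
  by rewrite big_pred0 // mul1r coef_poly dN.
pose i := Ordinal ln.
rewrite (bigD1 i) //= (eq_bigl (fun j : 'I_n => (j < l)%N)) => [|j]; last first.
  by rewrite -val_eqE /= ltnS ltn_neqAle andbC.
rewrite -mulrA mulrCA -(IH N d (ltnW ln) dN) !coefM.
apply: eq_bigr => j _; congr (_ * _).
have eN : (d - j < N)%N by apply: leq_ltn_trans (leq_subr _ _) dN.
move: (d - j)%N eN => e eN.
rewrite mulrBl mul1r coefB coefXnM !coef_poly eN.
have := hilb_from_step i e; rewrite /= => ->.
case: ltnP => [_|ie]; first by rewrite addn0 subr0.
by rewrite (leq_ltn_trans (leq_subr _ _) eN) natrD addrK.
Qed.

Lemma hilb_series : series_eq_ratio hilb hilb_num hilb_den.
Proof.
split=> [|d].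
  (* Every factor of the denominator takes the value 1 at 0, since [ydeg] is positive. *)
  apply/negP => /eqP /(congr1 (horner^~ 0)); rewrite horner0 horner_prod.
  move/eqP; rewrite prodf_seq_eq0 => /hasP[i _ /=].
  by rewrite !hornerE expr0n eqn0Ngt ydeg_gt0 // subr0 oner_eq0.
have := hilb_from_conv (leqnn n) (ltnSn d).
have -> : \prod_(i < n | (i < n)%N) (1 - 'X^(ydeg p i)) = hilb_den.
  by apply: eq_bigl => i; rewrite ltn_ord.
rewrite coefM => convE.
transitivity ((hilb_from 0 d)%:R : rat).
  rewrite -convE; apply: eq_bigr => j _.
  by rewrite coef_poly ltnS leq_subr hilb_fromE.
by rewrite coef_poly; case: leqP => // /hilb_from0_top ->.
Qed.

Lemma hilb_ratio :
  ratio_at hilb_num hilb_den qvar^-1 =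
    (- qvar) ^+ n * ratio_at hilb_num hilb_den qvar.
Proof.
apply: ratio_at_palindrome => [d dt|]; first by rewrite hilb_from0_sym.
by rewrite subnK // ydeg_sum_ge.
Qed.

End MonomialBasis.

(** * The algebras R(n,p) *)

Section PolyBasis.
Variables (k : fieldType) (n : nat).

Let prime2 : prime 2 := isT.

(** For [p = 2] the basis over the polynomial ring is the single element 1, in degree 0 and dual to
    itself. The bound by [mtop] rests on the integrality of the degree. *)
Definition poly_basis : monomial_basis n 2 (polyR k n 2) unit.
Proof.
apply: (@MonomialBasis k n 2 (polyR k n 2) unit
  (fun _ => (idfun : {linear {mpoly k[n]} -> {mpoly k[n]}}))
  (fun f _ => f) _ _ tt _ (fun _ _ _ => 1) _ _ (fun _ => 0) _ _ id) => //.
- by move=> x y /(_ tt).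
- by move=> x y _; rewrite !(big_pred1 tt) ?scale1r // => -[].
- by move=> d x; split=> [dx _|/(_ tt)]; rewrite subr0.
- by move=> [] []; rewrite oner_eq0.
- by rewrite addr0 mondeg_mtop2.
- by move=> z m _; rewrite addr0 => mz; apply: (@le_mtop _ _ prime2 z); left.
Defined.

End PolyBasis.

Section Exterior.
Variables (k : fieldType) (n p : nat).
Hypotheses (p_prime : prime p) (p_odd : p <> 2%N).
Local Notation A := {mpoly k[n]}.
Implicit Types (S T U : {set 'I_n}) (F G : ext A n).

Definition ext_coef S F : A := F S.

Fact ext_coef_linear S : linear (ext_coef S).
Proof. by move=> a F G; rewrite /ext_coef !ffunE. Qed.

HB.instance Definition _ S :=
  GRing.isLinear.Build k (ext A n) A *:%R (ext_coef S) (ext_coef_linear S).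

Definition ext_mk (f : A) S : ext A n := [ffun U => if U == S then f else 0].

(** The sign [ext_sign] taken in [k], where structure constants live. *)
Definition sign S T : k := if [disjoint S & T] then (-1) ^+ inversions S T else 0.

Lemma ext_signE S T (f : A) : ext_sign A S T * f = sign S T *: f.
Proof.
rewrite /ext_sign /sign; case: ifP => _; last by rewrite mul0r scale0r.
rewrite -[in LHS]signr_odd -[in RHS]signr_odd; case: odd => /=.
  by rewrite !expr1 mulN1r scaleN1r.
by rewrite !expr0 mul1r scale1r.
Qed.

Lemma ext_coefM F G U : ext_coef U (F * G) =
  \sum_S \sum_T (if S :|: T == U then sign S T else 0) *: (F S * G T).
Proof.
rewrite /ext_coef [LHS]ext_mulE; apply: eq_bigr => S _; apply: eq_bigr => T _.
by case: eqP; rewrite ?scale0r // ext_signE.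
Qed.

Lemma sign_neq0 S T : (sign S T != 0) = [disjoint S & T].
Proof. by rewrite /sign; case: ifP; rewrite ?signr_eq0 ?eqxx. Qed.

(** Duality is complementation of sets: [xi_S * xi_T] is, up to sign, the product of all the
    generators exactly when [T] is the complement of [S]. *)
Definition ext_basis : monomial_basis n p (polyextR k n p) {set 'I_n}.
Proof.
apply: (@MonomialBasis k n p (polyextR k n p) {set 'I_n} (fun S => ext_coef S)
  ext_mk _ _ set0 _ (fun S T U => if S :|: T == U then sign S T else 0) _ _
  (setdeg p) _ _ (@setC _)) => //.
- by move=> f S U; rewrite /= /ext_coef ffunE.
- by move=> x y xy; apply/ffunP.
- by apply/ffunP => U; rewrite !ffunE; case: eqP.
- exact: ext_coefM.
- move=> S U; rewrite set0U /sign -setI_eq0 set0I eqxx.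
  have -> : inversions set0 S = 0%N.
    by apply: eq_card0 => -[i j]; rewrite !inE.
  by case: eqP.
- by move=> S; apply: sumr_ge0 => i _; apply/ltW/xideg_gt0/eqP.
- exact: setCK.
- move=> S T; rewrite setC0; case: (eqVneq (S :|: T)) => [ST|ST]; last first.
    rewrite eqxx; apply/esym; apply: contraNF ST => /eqP ->.
    by rewrite setUCr.
  rewrite sign_neq0; apply/idP/eqP => [dST|->]; last first.
    by rewrite -setI_eq0 setICr.
  apply/setP => i; rewrite inE; have := in_setT i; rewrite -ST inE.
  by case: (boolP (i \in S)) => // iS _; rewrite (disjointFr dST iS).
- move=> S; rewrite setC0 /setdeg [RHS](bigID (mem S)) /=.
  by congr (_ + _); apply: eq_bigl => i; rewrite !inE.
- by rewrite setC0; apply: mondeg_mtop_odd.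
- by move=> z m S _; apply: (@le_mtop _ _ p_prime z); right.
Defined.

Lemma ext_coef0M F G : ext_coef set0 (F * G) = ext_coef set0 F * ext_coef set0 G.
Proof.
have sgn00 : sign set0 set0 = 1.
  rewrite /sign -setI_eq0 set0I eqxx /inversions eq_card0 // => -[i j].
  by rewrite !inE.
rewrite ext_coefM (bigD1 set0) //= [X in _ + X]big1 => [|S S0].
  rewrite addr0 (bigD1 set0) //= big1 => [|T T0].
    by rewrite setU0 eqxx sgn00 scale1r addr0.
  by rewrite set0U (negPf T0) scale0r.
by apply: big1 => T _; rewrite setU_eq0 (negPf S0) scale0r.
Qed.

(** Taking the coefficient of [xi_set0] is multiplicative and polynomials have no nilpotents.
    Conversely, if that coefficient is zero, the power [m] involves only sets of size at least [m],
    and none has size [n.+1]. *)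
Lemma ext_nilpotent F : (exists m : nat, F ^+ m = 0) <-> ext_coef set0 F = 0.
Proof.
rewrite /ext_coef; split=> [[m Fm]|F0].
  have : (F ^+ m) set0 = F set0 ^+ m.
    elim: m {Fm} => [|m IH]; first by rewrite !expr0 ffunE eqxx.
    by rewrite !exprS -[LHS]/(ext_coef _ _) ext_coef0M -IH.
  rewrite Fm ffunE => /esym/eqP; rewrite expf_eq0 => /andP[_].
  by move/eqP.
pose fil j G := forall S, (#|S| < j)%N -> G S = 0.
have filM i j G H : fil i G -> fil j H -> fil (i + j)%N (G * H).
  move=> Gi Hj U Uij; rewrite -[LHS]/(ext_coef _ _) ext_coefM.
  rewrite big1 // => S _; rewrite big1 // => T _.
  case: eqP => [STU|_]; last by rewrite scale0r.
  have [dST|/negPf ndST] := boolP [disjoint S & T]; last first.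
    by rewrite /sign ndST scale0r.
  have : (#|S| + #|T| < i + j)%N.
    by rewrite -cardsUI (disjoint_setI0 dST) cards0 addn0 STU.
  case: (ltnP #|S| i) => [/Gi ->|iS]; first by rewrite mul0r scaler0.
  case: (ltnP #|T| j) => [/Hj ->|jT]; first by rewrite mulr0 scaler0.
  by rewrite ltnNge leq_add.
have filX m : fil m (F ^+ m).
  elim: m => [|m IH] //; rewrite exprS -add1n; apply: filM => // S.
  by rewrite ltnS leqn0 cards_eq0 => /eqP ->.
exists n.+1; apply/ffunP => S; rewrite [RHS]ffunE; apply: filX.
by rewrite ltnS -[X in (_ <= X)%N]card_ord max_card.
Qed.

End Exterior.

(** * Krull dimension for p odd *)

Section OddKrull.
Variables (k : fieldType) (n p : nat).
Hypothesis p_prime : prime p.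
Local Notation E := (Int (polyextR k n p)).
Local Notation E0 := (Int_car (polyR k n p)).

Fact Int_polyR_mulC : commutative (@GRing.mul E0).
Proof. by move=> u v; apply: val_inj; rewrite !rmorphM; apply: mpoly_mulC. Qed.

HB.instance Definition _ :=
  GRing.PzSemiRing_hasCommutativeMul.Build E0 Int_polyR_mulC.

Fact reduced_int (u : E) : ext_coef set0 (val u) \in @int_pred k (polyR k n p).
Proof.
have /int_predP[s sP ->] := valP u; apply/int_predP.
exists [seq ext_coef set0 F | F <- s]; last by rewrite big_map linear_sum.
move=> f /mapP[F /sP[d /(_ set0) Fd] ->]; exists d.
by rewrite /setdeg big_set0 subr0 in Fd.
Qed.

(** The quotient by the nilpotents, realised as the integral part of the polynomial ring with the
    same degrees. *)
Definition reduced (u : E) : E0 := @IntCar k (polyR k n p) _ (reduced_int u).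

Fact reduced_is_additive : additive reduced.
Proof.
move=> u v; apply: val_inj; rewrite [RHS]raddfB /=.
by rewrite -[RHS]linearB; congr (ext_coef _ _).
Qed.

Fact reduced_is_monoid_morphism : monoid_morphism reduced.
Proof.
split=> [|u v]; apply: val_inj.
  by rewrite /= /ext_coef [RHS]rmorph1 ffunE eqxx.
by rewrite [RHS]rmorphM /= -ext_coef0M; congr (ext_coef _ _).
Qed.

HB.instance Definition _ :=
  GRing.isZmodMorphism.Build E E0 reduced reduced_is_additive.
HB.instance Definition _ :=
  GRing.isMonoidMorphism.Build E E0 reduced reduced_is_monoid_morphism.

Lemma Int_ext_nilpotent (u : E) : nilpotent u <-> ext_coef set0 (val u) = 0.
Proof.
have valX m : val (u ^+ m) = val u ^+ m := rmorphXn (Int_incl _) m u.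
rewrite -ext_nilpotent; split=> -[m um]; exists m.
  by rewrite -valX um raddf0.
by apply: val_inj; rewrite valX um raddf0.
Qed.

Lemma reduced_quotient : is_quotient reduced (@nilpotent E).
Proof.
split=> [f|u]; last first.
  rewrite Int_ext_nilpotent; split=> [/(congr1 val) //|u0].
  by apply: val_inj; rewrite raddf0.
(* The preimage [f * xi_set0] keeps the degrees of the homogeneous pieces of [f], as [setdeg] of the
   empty set is 0. *)
have fP : ext_mk (val f : {mpoly k[n]}) set0 \in @int_pred k (polyextR k n p).
  have /int_predP[s sP fs] := valP f; apply/int_predP.
  exists [seq ext_mk g set0 | g <- s].
    move=> F /mapP[g /sP[d gd] ->]; exists d => S; rewrite ffunE.
    case: eqP => [->|_]; last exact: poly_part0.
    by rewrite /setdeg big_set0 subr0.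
  rewrite big_map; apply/ffunP => S; rewrite sum_ffunE ffunE fs.
  case: eqP => [->|/eqP/negPf S0].
    by apply: eq_bigr => g _; rewrite ffunE eqxx.
  by rewrite big1 // => g _; rewrite ffunE S0.
exists (@IntCar k (polyextR k n p) _ fP); apply: val_inj.
by rewrite /= /ext_coef ffunE eqxx.
Qed.

Lemma krull_dim_odd : p <> 2%N -> krull_dim p E n.
Proof.
move=> /eqP/negPf p2; rewrite /krull_dim p2.
exists E0, reduced; split; first exact: reduced_quotient.
exact: com_krull_dim_Int_polyR.
Qed.

End OddKrull.

(** * Parity of degrees and graded commutativity for p odd *)

Section Parity.
Variables (p n : nat).
Hypotheses (p_prime : prime p) (p_odd : p <> 2%N).

Lemma odd_p : odd p.
Proof. by case: (even_prime p_prime). Qed.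

(** An odd factor [p ^ j] does not change parity; this is applied after clearing denominators. *)
Lemma odd_pM (j : nat) (a b : int) :
  a * p%:Z ^+ j = 2%:Z * b -> ~~ odd `|a|%N.
Proof.
move=> /(congr1 (fun c : int => odd `|c|%N)).
by rewrite !abszM abszX !oddM oddX /= odd_p orbT andbT => ->.
Qed.

(** Modulo even elements of Z[1/p], each [x_i] has degree 0 and each [xi_i] degree -1. Concretely,
    [|x_i| p^n] is twice the integer [p^n - p^(n-i)], so [(d + #|S|) p^n] is twice the integer
    [C]. *)
Lemma odd_setdeg (m : 'X_{1..n}) (S : {set 'I_n}) (d : int) :
  mondeg p m + setdeg p S = d%:~R -> odd `|d|%N = odd #|S|.
Proof.
move=> mS; have xE (i : 'I_n) : xdeg p i = 2%:R - 2%:R / p%:R ^+ i.+1.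
  rewrite /xdeg; case: eqP => // _.
  by rewrite mulrBr mulr1 mulrBl mulfK // expf_neq0 // pnatr_eq0 -lt0n prime_gt0.
pose c (i : 'I_n) := (p ^ (n - i.+1))%N.
have cE (i : 'I_n) : (c i)%:R = p%:R ^+ n / p%:R ^+ i.+1 :> rat.
  by rewrite natrX expfB_cond ?ltn_ord // pnatr_eq0 eqn0Ngt prime_gt0 // add0n.
pose C : int := \sum_i ((p ^ n)%:Z - (c i)%:Z) *+ m i
  + \sum_(i in S) ((p ^ n)%:Z - (c i)%:Z).
have key (i : 'I_n) :
    xdeg p i * p%:R ^+ n = 2%:R * ((p ^ n)%:Z - (c i)%:Z)%:~R.
  by rewrite intrB -!pmulrn cE xE natrX; ring.
have : (d + #|S|%:Z) * p%:Z ^+ n = 2%:Z * C.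
  apply: (@intr_inj rat); rewrite !intrM intrD -mS rmorphXn /= intrD.
  rewrite -!pmulrn -addrA mulrDl mulrDr; congr (_ + _).
    rewrite /mondeg mulr_suml rmorph_sum mulr_sumr; apply: eq_bigr => i _.
    by rewrite mulrnAl key rmorphMn mulrnAr.
  rewrite rmorph_sum mulr_sumr -sum1_card natr_sum -big_split mulr_suml.
  by apply: eq_bigr => i _; rewrite /= /xideg subrK key.
move=> /odd_pM; lia.
Qed.

(** Since [p] is odd, an integer that is twice an element of Z[1/p] is already even, so both notions
    of parity agree on integers. *)
Lemma oddZinvE (d e : int) :
  oddZinv p (d%:~R * e%:~R) = odd `|d|%N && odd `|e|%N.
Proof.
rewrite -oddM -abszM /oddZinv; apply/negP/idP => [H|de].
  rewrite -[odd _]negbK; apply/negP => de; apply: H; apply/boolp.asboolP.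
  exists ((d * e) %/ 2)%Z, 0%N; rewrite expr0 divr1 -intrM.
  have dv : (2%:Z %| d * e)%Z by rewrite dvdzE /= dvdn2.
  by rewrite -{1}(divzK dv) intrM mulfK.
move=> /boolp.asboolP[m [j mj]]; suff : ~~ odd `|(d * e)%R|%N by rewrite de.
apply: (@odd_pM j _ m); apply: (@intr_inj rat).
rewrite !intrM rmorphXn /= -[X in X * _](divfK (_ : 2%:R != 0)) // mj.
rewrite mulrAC divfK ?expf_neq0 // 1?mulrC //.
by rewrite pnatr_eq0 -lt0n prime_gt0.
Qed.

End Parity.

(** By disjointness the members of a pair in [S] times [T] are distinct, so each pair is counted by
    exactly one of the two terms. *)
Lemma inversionsC n (S T : {set 'I_n}) : [disjoint S & T] ->
  (inversions S T + inversions T S = #|S| * #|T|)%N.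
Proof.
move=> dST; rewrite -cardsX /inversions.
set I := [set ij | _]; set J := [set ij | _].
have -> : #|J| = #|[set (ij.2, ij.1) | ij in J]|.
  by rewrite card_imset // => -[i j] [i' j'] [-> ->].
rewrite -cardsUI (_ : _ :&: _ = set0) ?cards0 ?addn0; last first.
  apply/setP => -[i j]; rewrite !inE; apply/negP => /andP[/= /and3P[_ _ ji]].
  by case/imsetP => -[j' i']; rewrite inE /= => /and3P[_ _ ij] [ei ej]; subst; lia.
apply: eq_card => -[i j]; rewrite !inE /=.
apply/orP/andP => [[/and3P[] //|/imsetP[[j' i']]]|[iS jT]].
  by rewrite inE /= => /and3P[? ? _] [-> ->].
case: (ltngtP i j) => ij; last by have := disjointFr dST iS; rewrite (val_inj ij) jT.
  by right; apply/imsetP; exists (j, i); rewrite ?inE //= jT iS.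
by left; rewrite iS jT.
Qed.

(** Exchanging [xi_S] and [xi_T] costs [(-1)^(#|S| * #|T|)] by [inversionsC], and [odd_setdeg]
    identifies the parities of [#|S|] and [#|T|] with those of the degrees. *)
Lemma graded_commutative_odd (k : fieldType) (n p : nat) :
  prime p -> p <> 2%N -> graded_commutative p (Int (polyextR k n p)).
Proof.
move=> p_prime p_odd d e x y dx ey; rewrite oddZinvE //; apply: val_inj.
have part (c : int) (F : ext {mpoly k[n]} n) S :
    ext_part p c%:~R F -> F S != 0 -> odd `|c|%N = odd #|S|.
  move=> cF FS; have [m mS] : exists m, m \in msupp (F S).
    have := FS; rewrite -msupp_eq0; case: (msupp _) => // m s _.
    by exists m; rewrite inE eqxx.
  by apply: (@odd_setdeg p n p_prime p_odd m); rewrite (cF S m mS) subrK.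
set b := odd _ && odd _.
have -> : (-1) ^+ b * (x * y) = ((-1) ^+ b : k) *: (x * y).
  by case: b; rewrite ?expr1 ?expr0 ?mulN1r ?scaleN1r ?mul1r ?scale1r.
have valM (u v : Int (polyextR k n p)) : val (u * v) = val u * val v :=
  rmorphM (Int_incl _) u v.
have valZ (a : k) (u : Int (polyextR k n p)) : val (a *: u) = a *: val u :=
  linearZZ (Int_incl _) a u.
rewrite valZ !valM.
apply/ffunP => U.
transitivity ((-1) ^+ b *: ext_coef U (val x * val y)); last by rewrite [RHS]ffunE.
rewrite -[LHS]/(ext_coef U (val y * val x)) !ext_coefM scaler_sumr exchange_big.
apply: eq_bigr => S _.
rewrite scaler_sumr; apply: eq_bigr => T _ /=; rewrite setUC.
case: eqP => _; last by rewrite !scale0r scaler0.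
(* Homogeneity determines the parity of [#|S|] only where the coefficient is nonzero; the remaining
   terms vanish on both sides. *)
have [->|xS] := eqVneq ((val x : ext _ _) S) 0.
  by rewrite mul0r mulr0 !scaler0.
have [->|yT] := eqVneq ((val y : ext _ _) T) 0.
  by rewrite mul0r mulr0 !scaler0.
rewrite scalerA [in LHS]mulrC; congr (_ *: _).
rewrite /b !(part _ _ _ dx xS, part _ _ _ ey yT) /sign disjoint_sym.
case: ifP => dST; last by rewrite mulr0.
have := congr1 odd (inversionsC dST).
rewrite oddD oddM => <-; rewrite signr_addb !signr_odd.
by rewrite mulrAC -expr2 sqrr_sign mul1r.
Qed.

(** * Nilpotents for p odd, and the properties special to p = 2 *)

Lemma exists_nilpotent (k : fieldType) (n p : nat) :
  prime p -> p <> 2%N -> (0 < n)%N ->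
  exists2 x : Int (polyextR k n p), x <> 0 & nilpotent x.
Proof.
move=> p_prime p_odd; case: n => // n _.
(* The witness is [x_1^(p-1) xi_1], of degree [p |x_1| - 1 = 2(p - 1) - 1], an integer. For [n = 0]
   the algebra is [k] itself and has no such element. *)
pose z : 'X_{1..n.+1} * {set 'I_n.+1} :=
  ((U_(ord0) *+ p.-1)%MM, [set ord0]).
pose B := ext_basis k n.+1 p_prime p_odd.
have zi : wt_int B z.
  rewrite /wt_int /wt /= /mondeg (bigD1 ord0) //= big1 => [|i i0]; last first.
    by rewrite mulmnE mnm1E eq_sym (negPf i0).
  rewrite mulmnE mnm1E eqxx mul1n addr0 /setdeg big_set1 /xideg addrA -mulrSr.
  rewrite prednK ?prime_gt0 // -[p in _ *+ p]expn1 xdeg_mulrn //.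
  by rewrite rpredB // pmulrn intr_int.
exists (mkE B z).
  move=> z0; have := co_mkE z zi; rewrite z0 linear0 eqxx => /esym/eqP.
  by rewrite oner_eq0.
apply/Int_ext_nilpotent; rewrite val_mkE //.
by apply: etrans (coef_mono B z set0) _; rewrite eq_sym -cards_eq0 cards1.
Qed.

(** Halving stays inside Z[1/2], so every degree is even and the sign is trivial. *)
Lemma graded_commutative_two (k : fieldType) (n : nat) :
  graded_commutative 2 (Int (polyR k n 2)).
Proof.
move=> d e x y _ _; rewrite (_ : oddZinv _ _ = false) ?mul1r.
  exact: (@Int_polyR_mulC k n 2).
apply/negbTE; rewrite negbK; apply/boolp.asboolP; exists (d * e), 1%N.
by rewrite intrM.
Qed.

Lemma integral_domain_two (k : fieldType) (n : nat) :
  integral_domain (Int (polyR k n 2)).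
Proof.
split; first exact: (@Int_polyR_mulC k n 2).
move=> x y xy; have : (val x : {mpoly k[n]}) * val y == 0.
  by apply/eqP; have := congr1 val xy; rewrite raddf0 (rmorphM (Int_incl _)).
by rewrite mulf_eq0 => /orP[] /eqP xy0; [left|right]; apply: val_inj; rewrite raddf0.
Qed.

Theorem theorem1p1 (p : nat) (k : fieldType) (n : nat)
    (p_prime : prime p) (k_char : p \in [pchar k]) :
  [/\ graded_commutative p (algE k n p),
      finitely_generated (algE k n p),
      gorenstein p (algE k n p)
    & krull_dim p (algE k n p) n]
  /\ (p = 2%N -> integral_domain (algE k n p))
  /\ (p <> 2%N -> (0 < n)%N -> exists2 x : algE k n p, x <> 0 & nilpotent x)
  /\ exists h : nat -> nat, poincare_coef (algE k n p) h /\
     exists P Q : {poly rat}, series_eq_ratio h P Q /\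
       ratio_at P Q qvar^-1 = (- qvar) ^+ n * ratio_at P Q qvar.
Proof.
have [p2|/eqP p_odd] := eqVneq p 2%N.
  move: p_prime {k_char}; rewrite p2 => p_prime; pose B := poly_basis k n.
  have -> : algE k n 2 = Int (polyR k n 2) by [].
  have dimE : krull_dim 2 (Int (polyR k n 2)) n by apply: com_krull_dim_Int_polyR.
  split; last split=> [_|]; last split=> //; first split.
  - exact: graded_commutative_two.
  - exact: module_finite_generated (E_module_finite p_prime B).
  - exact: E_gorenstein p_prime B dimE.
  - exact: dimE.
  - exact: integral_domain_two.
  exists (hilb B); split; first exact: poincare_hilb.
  exists (hilb_num B), (hilb_den n 2).
  by split; [apply: hilb_series|apply: hilb_ratio].
have -> : algE k n p = Int (polyextR k n p).
  by rewrite /algE /algR (negPf (introN eqP p_odd)).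
pose B := ext_basis k n p_prime p_odd.
have dimE := krull_dim_odd k n p_prime p_odd.
split; last split=> //; last split=> [_ n_gt0|]; first split.
- exact: graded_commutative_odd.
- exact: module_finite_generated (E_module_finite p_prime B).
- exact: E_gorenstein p_prime B dimE.
- exact: dimE.
- exact: exists_nilpotent.
exists (hilb B); split; first exact: poincare_hilb.
exists (hilb_num B), (hilb_den n p).
by split; [apply: hilb_series|apply: hilb_ratio].
Qed.
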